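(* For $1<p<3$ let $p^*=3p/(3-p)$ and let $C(p)$ be the optimal (smallest) constant such that $$\left( \int_{\mathbb{R}^3} |f(\mathbf{x})|_{p^*}^{p^*}\, d\mathbf{x} \right)^{1/p^*} \le C(p) \left( \int_{\mathbb{R}^3} |(\boldsymbol{\sigma}\cdot\mathbf{p}) f(\mathbf{x})|_p^{p}\, d\mathbf{x} \right)^{1/p}$$ for all $f\in C_0^\infty(\mathbb{R}^3,\mathbb{C}^2)$. Then for every $1<p<3$ $$C(p) \ge \pi^{-1/3}\, 2^{-2-1/p}\, 3^{-1/3-1/p}\, \frac{p^{-1/3}(4p-3)^{1/p}}{(p-1)^{1/p-1/3}},$$ and consequently $C(p)\to\infty$ as $p\downarrow 1$.
   Context: $C_0^\infty(\mathbb{R}^3,\mathbb{C}^2)$ is the space of $\mathbb{C}^2$-valued functions on $\mathbb{R}^3$ whose components are smooth with compact support. The Pauli matrices are $\sigma_1=\begin{pmatrix}0&1\\1&0\end{pmatrix}$, $\sigma_2=\begin{pmatrix}0&-i\\i&0\end{pmatrix}$, $\sigma_3=\begin{pmatrix}1&0\\0&-1\end{pmatrix}$, and $\boldsymbol{\sigma}\cdot\mathbf{p} = -i\sum_{j=1}^3 \sigma_j \frac{\partial}{\partial x_j}$. For $\mathbf{a}=(a_1,a_2)\in\mathbb{C}^2$ and $p\ge 1$, $|\mathbf{a}|_p^p = |a_1|^p+|a_2|^p$. For $1<p<3$ a finite constant $C(p)$ as in the claim exists. *)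

(* Defs.v *)
From mathcomp Require Export all_boot all_order all_algebra.
From mathcomp Require Export complex.
From mathcomp Require Export all_classical all_reals all_analysis.
Export numFieldNormedType.Exports.

Set Implicit Arguments.
Unset Strict Implicit.
Unset Printing Implicit Defensive.

Import Order.TTheory GRing.Theory Num.Theory.

Local Open Scope classical_set_scope.
Local Open Scope ring_scope.

(* R^3 is the product [R * R * R], which carries both the normed-space
   structure used for derivatives and the product sigma-algebra used for
   integration. Coordinates and Pauli matrices are numbered 0, 1, 2. *)
Notation space R := (R * R * R)%type.
Notation spinor R := 'cV[R[i]]_2.

(* [measurableTypeR R] is R with the Borel sigma-algebra. *)
Definition lebesgue3 (R : realType) :
    {measure set (space (measurableTypeR R)) -> \bar R} :=
  ((@lebesgue_measure R \x @lebesgue_measure R) \x @lebesgue_measure R)%E.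

Definition basis3 (R : realType) (j : 'I_3) : space R :=
  ((j == 0 :> nat)%:R, (j == 1 :> nat)%:R, (j == 2 :> nat)%:R).

(* [:: j1; ...; jk] stands for d_{j1} ... d_{jk}. *)
Definition iter_partial (R : realType) (s : seq 'I_3) (g : space R -> R) :
    space R -> R :=
  foldr (fun j h => 'D_(basis3 R j) h) g s.

(* ['D_v] is a total operator, so the existence of each partial derivative has
   to be required explicitly. *)
Definition smooth (R : realType) (g : space R -> R) : Prop :=
  forall s : seq 'I_3,
    continuous (iter_partial s g) /\
    forall (j : 'I_3) (x : space R),
      derivable (iter_partial s g) x (basis3 R j).

Definition test_spinor (R : realType) (f : space R -> spinor R) : Prop :=
  (forall k : 'I_2, smooth (fun x => complex.Re (f x k 0)) /\
                    smooth (fun x => complex.Im (f x k 0))) /\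
  compact (closure [set x | f x != 0]).

(* Partial derivatives of C^2-valued functions are taken on the real and
   imaginary parts of the components, R[i] not being a normed R-module. *)
Definition partial (R : realType) (j : 'I_3) (f : space R -> spinor R)
    (x : space R) : spinor R :=
  \col_k ('D_(basis3 R j) (fun y => complex.Re (f y k 0)) x +i*
          'D_(basis3 R j) (fun y => complex.Im (f y k 0)) x)%C.

Definition mx_of_rows (R : realType) (rows : seq (seq R[i])) : 'M[R[i]]_2 :=
  \matrix_(k, l) nth 0 (nth [::] rows k) l.

Definition pauli (R : realType) (j : 'I_3) : 'M[R[i]]_2 :=
  nth 0 [:: mx_of_rows [:: [:: 0; 1]; [:: 1; 0]];
            mx_of_rows [:: [:: 0; - 'i%C]; [:: 'i%C; 0]];
            mx_of_rows [:: [:: 1; 0]; [:: 0; - 1]]] j.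

Definition sigma_p (R : realType) (f : space R -> spinor R) (x : space R) :
    spinor R :=
  (- 'i%C) *: \sum_(j < 3) pauli R j *m partial j f x.

(* |a|_p^p *)
Definition norm_pow (R : realType) (p : R) (a : spinor R) : R :=
  \sum_(k < 2) ComplexField.Normc.normc (a k 0) `^ p.

Definition sobolev_exponent (R : realType) (p : R) : R := 3 * p / (3 - p).

Definition dirac_sobolev (R : realType) (p K : R) : Prop :=
  forall f : space R -> spinor R, test_spinor f ->
    ((\int[lebesgue3 R]_x (norm_pow (sobolev_exponent p) (f x))%:E)
        `^ (1 / sobolev_exponent p)
     <= K%:E * (\int[lebesgue3 R]_x (norm_pow p (sigma_p f x))%:E)
        `^ (1 / p))%E.

Definition optimal_constant (R : realType) (p C : R) : Prop :=
  dirac_sobolev p C /\ forall K : R, dirac_sobolev p K -> C <= K.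

(* Main.v *)
Require Import Defs.
From mathcomp Require Import ring lra measurable_realfun.
Import Order.TTheory GRing.Theory Num.Theory.
Local Open Scope classical_set_scope.
Local Open Scope ring_scope.

Set Implicit Arguments.
Unset Strict Implicit.
Unset Printing Implicit Defensive.

(* For f(x) = (sigma.x) h(|x|^2) e_1 one has
   (sigma.p) f = -i (3 h + 2 s h')(s) e_1 at s = |x|^2, the factor being the
   divergence of the field x h(|x|^2). With h = min(1, s^(-3/2)) this factor is
   3 on the unit ball and 0 outside (x / |x|^3 is divergence free), while |f|
   decays like |x|^(-2), whose q-th power, q = 3p / (3 - p), is barely integrable
   at infinity when p is close to 1. The test functions use the smooth profile
   (1 + s^n)^(-3/(2n)), n -> oo, times the cutoff exp(1 - 1 / (1 - (s/rho^2)^2)),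
   rho -> oo. Of the Lebesgue measure only the scaling V r^3 of the volume of
   balls is needed: |f|^q is bounded below on the shells l^k <= |x| < l^(k+1)
   and summed as a geometric series, with l -> 1. In the limit this gives
   V^(1/q) (3 / (2q - 3))^(1/q) / sqrt 2 <= 3 C V^(1/p), and V <= 8 is enough. *)

(** Why V <= 8 is enough: 1/q - 1/p = -1/3, so after cancellation the volume survives only as
    V^(1/3) <= 2, and C is at least ((3 - p) / (3 (p - 1)))^(1/p - 1/3) / (6 sqrt 2), where 6 = 3 *
    2. The base blows up as p decreases to 1 while the exponent tends to 2/3, whence C(p) -> oo. The
    stated constant has the same singular power of p - 1, and the quotient of the two leaves enough
    room for pi >= 3 and ln 2 >= 2/3 to settle the comparison. The obstacle is that the limiting
    field is neither smooth nor compactly supported, and cutting it off creates a divergence on a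
    region of volume of order rho^3. The cutoff is shaped so that this extra divergence is pointwise
    at most a constant times rho^-3; its p-th power then integrates to order rho^(3 - 3p), which
    vanishes because p > 1. *)

(** * Smoothness through function algebras closed under partial derivatives *)

Inductive algebra_of (R : realType) (G : set (space R -> R)) :
    (space R -> R) -> Prop :=
| algebra_gen g : G g -> algebra_of G g
| algebra_cst c : algebra_of G (cst c)
| algebra_add g h : algebra_of G g -> algebra_of G h -> algebra_of G (g \+ h)
| algebra_mul g h : algebra_of G g -> algebra_of G h -> algebra_of G (g \* h).

Lemma algebra_of_diff (R : realType) (G : set (space R -> R)) :
  (forall g, G g -> (forall x, differentiable g x) /\
    forall j, algebra_of G ('D_(basis3 R j) g)) ->
  forall g, algebra_of G g -> (forall x, differentiable g x) /\
    forall j, algebra_of G ('D_(basis3 R j) g).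
Proof.
move=> GP g.
elim => {g} [g /GP//|c|g h Ag [dg Dg] Ah [dh Dh]|g h Ag [dg Dg] Ah [dh Dh]].
- split=> [x|j]; first exact: differentiable_cst.
  rewrite (_ : 'D_(basis3 R j) (cst c) = cst 0); first exact: algebra_cst.
  by apply/funext => x; rewrite derive_cst.
- split=> [x|j]; first exact: differentiableD.
  rewrite (_ : 'D_(basis3 R j) (g \+ h) =
    'D_(basis3 R j) g \+ 'D_(basis3 R j) h); first exact: algebra_add.
  by apply/funext => x; rewrite deriveD//; exact: diff_derivable.
- split=> [x|j]; first exact: differentiableM.
  rewrite (_ : 'D_(basis3 R j) (g \* h) =
    (g \* 'D_(basis3 R j) h) \+ (h \* 'D_(basis3 R j) g)).
    by apply: algebra_add; apply: algebra_mul.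
  by apply/funext => x; rewrite deriveM//; exact: diff_derivable.
Qed.

(** [smooth] speaks of iterated partial derivatives of every order. If the derivatives of the
    generators stay in the algebra, so do all iterated ones, and one differentiability statement for
    the algebra covers every order. *)
Lemma smooth_algebra (R : realType) (G : set (space R -> R)) :
  (forall g, G g -> (forall x, differentiable g x) /\
    forall j, algebra_of G ('D_(basis3 R j) g)) ->
  forall g, algebra_of G g -> smooth g.
Proof.
move=> /algebra_of_diff GP g Ag s.
have Ags : algebra_of G (iter_partial s g).
  by elim: s => [//|j s IHs] /=; exact: (GP _ IHs).2.
have [dg _] := GP _ Ags; split=> [x|j x].
- exact: differentiable_continuous.
- exact: diff_derivable.
Qed.

(** * Derivatives of coordinates and of radial functions *)

(** Radial functions are written in the variable s = |x|^2 instead of |x|: it is a polynomial, so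
    composing with it causes no trouble at the origin. *)
Definition sqnorm (R : realType) (x : space R) : R :=
  x.1.1 ^+ 2 + x.1.2 ^+ 2 + x.2 ^+ 2.

Definition coord (R : realType) (j : 'I_3) (x : space R) : R :=
  if j == 0 :> nat then x.1.1 else if j == 1 :> nat then x.1.2 else x.2.

Section projections.
Context (R : realType) (U V : normedModType R).

Let fstL : {linear (U * V)%type -> U} := fst.
Let sndL : {linear (U * V)%type -> V} := snd.

Lemma is_diff_fst (x : U * V) : is_diff x (fst : (U * V)%type -> U) fst.
Proof.
have fst_cont : continuous (fst : (U * V)%type -> U) by move=> y; exact: cvg_fst.
apply: DiffDef; first exact: (linear_differentiable (f := fstL)).
exact: (diff_lin (f := fstL)).
Qed.

Lemma is_diff_snd (x : U * V) : is_diff x (snd : (U * V)%type -> V) snd.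
Proof.
have snd_cont : continuous (snd : (U * V)%type -> V) by move=> y; exact: cvg_snd.
apply: DiffDef; first exact: (linear_differentiable (f := sndL)).
exact: (diff_lin (f := sndL)).
Qed.

End projections.

Lemma is_diff_coord (R : realType) (j : 'I_3) (x : space R) :
  is_diff x (coord j) (coord j).
Proof.
rewrite /coord; case: (j == 0 :> nat); last case: (j == 1 :> nat).
- exact: (is_diff_comp (is_diff_fst x) (is_diff_fst x.1)).
- exact: (is_diff_comp (is_diff_fst x) (is_diff_snd x.1)).
- exact: is_diff_snd.
Qed.

Lemma differentiable_coord3 (R : realType) (j : 'I_3) (x : space R) :
  differentiable (coord j) x.
Proof. by have := is_diff_coord j x => ?; exact: ex_diff. Qed.

Lemma derive_coord (R : realType) (i j : 'I_3) (x : space R) :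
  'D_(basis3 R i) (coord j) x = (i == j)%:R.
Proof.
rewrite deriveE; last exact: differentiable_coord3.
have -> : 'd (coord j) x = coord j :> (space R -> R).
  by have := is_diff_coord j x => ?; exact: diff_val.
by case: i j => [[|[|[|//]]] ?] [[|[|[|//]]] ?].
Qed.

Lemma sqnormE (R : realType) : @sqnorm R =
  (coord ord0 \* coord ord0 \+ coord (inord 1) \* coord (inord 1)) \+
    coord ord_max \* coord ord_max.
Proof. by apply/funext => x; rewrite /sqnorm /= /coord /= !inordK. Qed.

Lemma differentiable_sqnorm (R : realType) (x : space R) :
  differentiable (@sqnorm R) x.
Proof.
rewrite sqnormE; apply: differentiableD; first apply: differentiableD;
 apply: differentiableM; exact: differentiable_coord3.
Qed.

Lemma derive_sqnorm (R : realType) (i : 'I_3) (x : space R) :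
  'D_(basis3 R i) (@sqnorm R) x = 2 * coord i x.
Proof.
have dc j : derivable (coord j) x (basis3 R i).
  exact/diff_derivable/differentiable_coord3.
have dcc j : derivable (coord j \* coord j) x (basis3 R i).
  exact: derivableM.
rewrite sqnormE !deriveD ?deriveM//=; last exact: derivableD.
rewrite !derive_coord /coord /= !inordK//.
rewrite -!val_eqE /= !inordK//.
by case: i {dc dcc} => [[|[|[|//]]] ?] /=; rewrite /GRing.scale/=; ring.
Qed.

Lemma radial_differentiable (R : realType) (h : R -> R) (dh : R) (x : space R) :
  is_derive (sqnorm x) 1 h dh -> differentiable (h \o @sqnorm R) x.
Proof.
move=> [h1 _]; apply: differentiable_comp; first exact: differentiable_sqnorm.
exact/derivable1_diffP.
Qed.

Lemma derive_radial (R : realType) (h : R -> R) (dh : R) (i : 'I_3)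
    (x : space R) : is_derive (sqnorm x) 1 h dh ->
  'D_(basis3 R i) (h \o @sqnorm R) x = 2 * coord i x * dh.
Proof.
move=> hx; rewrite deriveE; last exact: radial_differentiable hx.
case: hx => h1 h2; rewrite diff_comp /=; last 2 first.
- exact: differentiable_sqnorm.
- exact/derivable1_diffP.
rewrite deriv1E// derive1E h2 -deriveE; last exact: differentiable_sqnorm.
by rewrite derive_sqnorm.
Qed.

(** * The flat function exp(-1/t) and its derivatives *)

(* The derivatives of exp (-1 / t) are linear combinations of these functions. *)
Definition flat (R : realType) (k : nat) (t : R) : R :=
  if 0 < t then t ^- k * expR (- t^-1) else 0.

Lemma flat_ge0 (R : realType) (k : nat) (t : R) : 0 <= flat k t.
Proof.
rewrite /flat; case: ifPn => // t0.
by rewrite mulr_ge0 ?expR_ge0// invr_ge0 exprn_ge0// ltW.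
Qed.

(** With u = 1/t and N = k + m + 1 this is u^N / N! <= exp u. The case m = 1 gives differentiability
    at 0, the case m = 0 a uniform bound for the cutoff. *)
Lemma flat_le (R : realType) (k m : nat) (t : R) : 0 <= t ->
  flat k t <= (k + m).+1`!%:R * t ^+ m.+1.
Proof.
move=> t0; rewrite /flat; case: ifPn => [{}t0|_]; last first.
  by rewrite mulr_ge0// exprn_ge0.
have u0 : 0 < t^-1 by rewrite invr_gt0.
have f0 : 0 < (k + m).+1`!%:R :> R by rewrite ltr0n fact_gt0.
have h : t^-1 ^+ (k + m).+1 <= (k + m).+1`!%:R * expR t^-1.
  rewrite mulrC -ler_pdivrMr// (le_trans _ (expR_ge1Dxn (k + m) (ltW u0)))//.
  by rewrite lerDr.
rewrite expRN ler_pdivrMr ?expR_gt0//.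
rewrite -(ler_pM2l (exprn_gt0 m.+1 u0)) -exprVn -exprD addSn addnC.
apply: (le_trans h); rewrite exprVn mulrA [_^-1 * _]mulrCA mulVf ?mulr1//.
by rewrite expf_neq0// gt_eqF.
Qed.

Lemma is_derive0_quadratic (R : realType) (h : R -> R) (C : R) :
  (forall t, `|h t| <= C * t ^+ 2) -> is_derive (0 : R) 1 h 0.
Proof.
move=> hC; have h0 : h 0 = 0.
  by apply/eqP; rewrite -normr_le0 (le_trans (hC 0))// expr0n/= mulr0.
suff H : t^-1 *: ((h \o shift 0) (t *: (1 : R)) - h 0) @[t --> 0^'] --> (0 : R).
  split; first by apply/cvg_ex; exists 0.
  exact: cvg_lim H.
apply/cvgr0Pnorm_le => e e0; near=> t.
have t0 : t != 0 by near: t; exact: nbhs_dnbhs_neq.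
have te : `|t| <= e / (`|C| + 1).
  by near: t; apply: dnbhs0_le; rewrite divr_gt0// ltr_wpDl.
rewrite h0 subr0 /= addr0 /GRing.scale/= mulr1 normrM normfV.
rewrite ler_pdivrMl ?normr_gt0// (le_trans (hC t))//.
rewrite -real_normK ?num_real// expr2 mulrCA ler_pM2l ?normr_gt0//.
rewrite (le_trans (ler_wpM2r _ (ler_norm C)))//.
rewrite (le_trans (ler_wpM2l _ te))// mulrCA ger_pMr//.
by rewrite ler_pdivrMr ?mul1r ?lerDl// ltr_wpDl.
Unshelve. all: by end_near. Qed.

(** Away from 0 this is the product rule. At 0, [flat_le] with m = 1 makes [flat k] quadratically
    small, so the derivative there is 0. The family is thus closed under differentiation on the
    whole line. *)
Lemma is_derive_flat (R : realType) (k : nat) (t : R) :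
  is_derive t 1 (flat k) (flat k.+2 t - k%:R * flat k.+1 t).
Proof.
have [t0|t0|->] := ltgtP t 0.
- rewrite /flat !ltNge (ltW t0)/= mulr0 subr0.
  apply: (near_eq_is_derive (f := cst 0)); near=> z.
  rewrite /= ifF// lt_gtF//; near: z; exact: lt_nbhsl.
- apply: (near_eq_is_derive
    (f := (fun z => (z^-1) ^+ k * expR (- z^-1)) : R -> R)).
    near=> z; rewrite /flat ifT ?exprVn//; near: z; exact: lt_nbhsr.
  have dV : is_derive t 1 (fun z : R => z^-1) (- t ^- 2).
    apply: DeriveDef; first exact: derivableV (lt0r_neq0 t0) _.
    by rewrite deriveV ?gt_eqF// derive_id /GRing.scale/= mulr1.
  have dX : is_derive t 1 ((fun z : R => z^-1) ^+ k)
      (k%:R * t^-1 ^+ k.-1 *: - t ^- 2) by exact: is_deriveX.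
  have dE : is_derive t 1 (expR \o - (fun z : R => z^-1))
      (expR (- t^-1) * - - t ^- 2) by exact: is_derive1_comp.
  rewrite (_ : (fun z => _) =
    (fun z : R => z^-1) ^+ k * (expR \o - (fun z : R => z^-1))); last first.
    by apply/funext => z; rewrite mulrfctE exprfctE.
  apply: (is_derive_eq (is_deriveM dX dE)).
  rewrite /flat ifT// ifT// /GRing.scale/= -!exprVn exprfctE.
  rewrite (_ : (- _) t = - t^-1)//; case: k {dX} => [|k] /=;
    last by rewrite !exprS; ring.
  by rewrite !mul0r; ring.
- rewrite (_ : _ - _ = 0); last by rewrite /flat ltxx mulr0 subr0.
  apply: (@is_derive0_quadratic _ _ (k + 1).+1`!%:R) => z.
  rewrite ger0_norm ?flat_ge0//; have [z0|z0] := leP 0 z.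
    exact: flat_le.
  by rewrite /flat ltNge (ltW z0)/= mulr_ge0// sqr_ge0.
Unshelve. all: by end_near. Qed.

(** * One-variable profile and cutoff *)

(** Differentiating [profile] lowers its exponent by one, which amounts to a factor [pole]; with it
    as a generator the algebra is closed. For large n it approximates the indicator of s < 1. *)
Definition pole (R : realType) (n : nat) (s : R) : R := (1 + s ^+ n)^-1.

(* Tends to min(1, s^(-3/2)) as n -> oo. *)
Definition profile (R : realType) (n : nat) (s : R) : R :=
  (1 + s ^+ n) `^ (- (3 / (2 * n%:R))).

(** The square of [s / rho ^+ 2] matters: without it the divergence due to the cutoff would have
    size rho^-2 near the unit sphere, and bounding it by a constant over a ball of volume of order
    rho^3 would fail for p <= 3/2. The index k is there for the derivatives. *)
Definition cutoff (R : realType) (k : nat) (rho s : R) : R :=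
  flat k (1 - (s / rho ^+ 2) ^+ 2).

Section profile_derivatives.
Context (R : realType).
Implicit Types (n k : nat) (s rho : R).

Let is_derive_base n s :
  is_derive s 1 (cst 1 + id ^+ n : R -> R) (n%:R * s ^+ n.-1).
Proof. by apply: is_derive_eq; rewrite add0r /GRing.scale/= mulr1. Qed.

Let baseE n s : (cst 1 + id ^+ n : R -> R) s = 1 + s ^+ n.
Proof. by rewrite addrfctE exprfctE. Qed.

Let base_gt0 n s : 0 <= s -> 0 < 1 + s ^+ n.
Proof. by move=> s0; rewrite ltr_wpDr// exprn_ge0. Qed.

Lemma is_derive_pole n s : 0 <= s ->
  is_derive s 1 (pole n) (- (n%:R * s ^+ n.-1 * pole n s ^+ 2)).
Proof.
move=> s0; have b0 := lt0r_neq0 (base_gt0 n s0).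
have db := is_derive_base n s.
have -> : pole n = (fun z => ((cst 1 + id ^+ n : R -> R) z)^-1).
  by apply/funext => z; rewrite /pole baseE.
apply: DeriveDef.
  by apply: derivableV; [rewrite baseE|].
rewrite deriveV//=; last by rewrite baseE.
rewrite derive_val /pole baseE /GRing.scale/=.
by rewrite exprVn mulNr mulrC.
Qed.

Lemma is_derive_profile n s : (0 < n)%N -> 0 <= s ->
  is_derive s 1 (profile n) (- (3 / 2 * s ^+ n.-1 * (pole n s * profile n s))).
Proof.
move=> n0 s0; have b0 := base_gt0 n s0.
have db := is_derive_base n s.
have dp := is_derive1_powR (- (3 / (2 * n%:R))) b0.
rewrite -baseE in dp.
rewrite [X in is_derive _ _ X _](_ : _ =
    (powR (R:=R))^~ (- (3 / (2 * n%:R))) \o (cst 1 + id ^+ n : R -> R)); last first.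
  by apply/funext => z; rewrite /profile /= baseE.
apply: (is_derive_eq (is_derive1_comp dp db)).
rewrite baseE powRB; last by rewrite lt0r_neq0 ?implybT.
rewrite powRr1 ?ltW// /pole /profile.
have n1 : n%:R != 0 :> R by rewrite pnatr_eq0 -lt0n.
move: (_ `^ _) => P.
move: (s ^+ n.-1) (1 + s ^+ n) b0 => a b /lt0r_neq0 b0; field; by apply/andP.
Qed.

Lemma is_derive_cutoff k rho s : rho != 0 ->
  is_derive s 1 (cutoff k rho)
    (- (2 * s / rho ^+ 4) * (cutoff k.+2 rho s - k%:R * cutoff k.+1 rho s)).
Proof.
move=> rho0.
have dg : is_derive s 1 (cst 1 - (rho ^+ 4)^-1 *: (id ^+ 2) : R -> R)
    (- (2 * s / rho ^+ 4)).
  apply: is_derive_eq; rewrite /GRing.scale/= expr1 mulr1 sub0r.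
  by congr (- _); rewrite mulrC.
have E z : (cst 1 - (rho ^+ 4)^-1 *: (id ^+ 2) : R -> R) z =
    1 - (z / rho ^+ 2) ^+ 2.
  rewrite addrfctE opprfctE scalrfctE exprfctE /GRing.scale/=.
  by field.
have -> : cutoff k rho =
    flat k \o (cst 1 - (rho ^+ 4)^-1 *: (id ^+ 2) : R -> R).
  by apply/funext => z; rewrite /= E.
have df := is_derive_flat k ((cst 1 - (rho ^+ 4)^-1 *: (id ^+ 2) : R -> R) s).
apply: (is_derive_eq (is_derive1_comp df dg)).
by rewrite !E mulrC.
Qed.

End profile_derivatives.

(** * Smoothness of the test functions *)

Lemma algebra_of_eq (R : realType) (G : set (space R -> R)) (g h : space R -> R) :
  g =1 h -> algebra_of G g -> algebra_of G h.
Proof. by move=> /funext ->. Qed.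

Lemma sqnorm_ge0 (R : realType) (x : space R) : 0 <= sqnorm x.
Proof. by rewrite /sqnorm !addr_ge0// sqr_ge0. Qed.

(** The derivative of [h] is asked for on s >= 0, the range of [sqnorm]: at negative s the quantity
    1 + s^n in [pole] and [profile] can vanish. *)
Lemma algebra_of_radial (R : realType) (G : set (space R -> R))
    (h dh : R -> R) : (forall j, G (coord j)) ->
  (forall s : R, 0 <= s -> is_derive s 1 h (dh s)) ->
  algebra_of G (dh \o @sqnorm R) ->
  (forall x, differentiable (h \o @sqnorm R) x) /\
  forall j, algebra_of G ('D_(basis3 R j) (h \o @sqnorm R)).
Proof.
move=> Gcoord hP Adh; split=> [x|j].
  exact: radial_differentiable (hP _ (sqnorm_ge0 x)).
apply: (@algebra_of_eq _ _ ((cst 2 \* coord j) \* (dh \o @sqnorm R))).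
  by move=> x; rewrite (derive_radial _ (hP _ (sqnorm_ge0 x))).
apply: algebra_mul => //; apply: algebra_mul; first exact: algebra_cst.
exact/algebra_gen/Gcoord.
Qed.

(** Every order k of the cutoff is a generator, because differentiating order k produces the orders
    k + 1 and k + 2. *)
Inductive bump_generator (R : realType) (n : nat) (rho : R) :
    set (space R -> R) :=
| gen_coord j : bump_generator n rho (coord j)
| gen_pole : bump_generator n rho (pole n \o @sqnorm R)
| gen_profile : bump_generator n rho (profile n \o @sqnorm R)
| gen_cutoff k : bump_generator n rho (cutoff k rho \o @sqnorm R).

(* The factor [expR 1] normalizes the cutoff to 1 at the origin. *)
Definition amplitude (R : realType) (n : nat) (rho s : R) : R :=
  profile n s * (expR 1 * cutoff 0 rho s).

Section smoothness.
Context (R : realType) (n : nat) (rho : R).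
Hypotheses (n0 : (0 < n)%N) (rho0 : rho != 0).
Let G : set (space R -> R) := bump_generator n rho.

Let Aexp (g : space R -> R) k : algebra_of G g -> algebra_of G (fun x => g x ^+ k).
Proof.
move=> Ag; elim: k => [|k IHk].
  by apply: algebra_of_eq (algebra_cst _ 1) => x.
by apply: algebra_of_eq (algebra_mul Ag IHk) => x; rewrite exprS.
Qed.

Let Asqnorm : algebra_of G (@sqnorm R).
Proof.
rewrite sqnormE; apply: algebra_add; first apply: algebra_add;
  by apply: algebra_mul; apply: algebra_gen; exact: gen_coord.
Qed.

Let Gpole := algebra_gen (gen_pole n rho).
Let Gprofile := algebra_gen (gen_profile n rho).
Let Gcutoff k := algebra_gen (gen_cutoff n rho k).

Lemma bump_generator_diff (g : space R -> R) : G g ->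
  (forall x, differentiable g x) /\
  forall j, algebra_of G ('D_(basis3 R j) g).
Proof.
have Gc j : G (coord j) by exact: gen_coord.
case=> {g} [j|||k].
- split=> [x|i]; first exact: differentiable_coord3.
  apply: algebra_of_eq (algebra_cst _ (i == j)%:R) => x.
  by rewrite derive_coord.
- apply: (algebra_of_radial Gc (is_derive_pole n)).
  apply: (@algebra_of_eq _ _ ((cst (- n%:R) \* (fun x => sqnorm x ^+ n.-1)) \*
    (fun x => (pole n \o @sqnorm R) x ^+ 2))).
    by move=> x /=; rewrite !mulNr.
  apply: algebra_mul; last exact: Aexp.
  by apply: algebra_mul; [exact: algebra_cst|exact: Aexp].
- apply: (algebra_of_radial Gc (fun s => @is_derive_profile R n s n0)).
  apply: (@algebra_of_eq _ _ ((cst (- (3 / 2)) \* (fun x => sqnorm x ^+ n.-1)) \*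
    ((pole n \o @sqnorm R) \* (profile n \o @sqnorm R)))).
    by move=> x /=; rewrite !mulNr.
  apply: algebra_mul; last exact: algebra_mul.
  by apply: algebra_mul; [exact: algebra_cst|exact: Aexp].
- apply: (algebra_of_radial Gc (fun s _ => is_derive_cutoff k s rho0)).
  apply: (@algebra_of_eq _ _ ((cst (- (2 / rho ^+ 4)) \* @sqnorm R) \*
    ((cutoff k.+2 rho \o @sqnorm R) \+
      cst (- k%:R) \* (cutoff k.+1 rho \o @sqnorm R)))).
    by move=> x /=; rewrite mulNr; congr (_ * _); rewrite mulNr mulrAC.
  apply: algebra_mul; first by apply: algebra_mul => //; exact: algebra_cst.
  by apply: algebra_add => //; apply: algebra_mul => //; exact: algebra_cst.
Qed.

Lemma smooth_coord_amplitude (j : 'I_3) :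
  smooth (fun x : space R => coord j x * amplitude n rho (sqnorm x)).
Proof.
apply: (smooth_algebra bump_generator_diff).
apply: (@algebra_of_eq _ _ (coord j \* ((profile n \o @sqnorm R) \*
  (cst (expR 1) \* (cutoff 0 rho \o @sqnorm R))))) => //.
apply: algebra_mul; first exact/algebra_gen/gen_coord.
by apply: algebra_mul => //; apply: algebra_mul => //; exact: algebra_cst.
Qed.

End smoothness.

Lemma smooth_cst (R : realType) (c : R) : smooth (cst c : space R -> R).
Proof. by apply: (@smooth_algebra _ set0) => [g []|]; exact: algebra_cst. Qed.

(** * The Dirac operator on hedgehog spinors *)

(* (sigma.x) h(|x|^2) applied to the first basis spinor. *)
Definition hedgehog (R : realType) (h : R -> R) (x : space R) : spinor R :=
  \col_k (if k == 0 then ((coord ord_max x * h (sqnorm x)) +i* 0)%C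
          else ((coord ord0 x * h (sqnorm x)) +i*
                (coord (inord 1) x * h (sqnorm x)))%C).

Lemma derive_coord_radial (R : realType) (h : R -> R) (dh : R) (i j : 'I_3)
    (x : space R) : is_derive (sqnorm x) 1 h dh ->
  'D_(basis3 R i) (fun y => coord j y * h (sqnorm y)) x =
    (i == j)%:R * h (sqnorm x) + coord j x * (2 * coord i x * dh).
Proof.
move=> hx; rewrite (_ : (fun y => _) = coord j \* (h \o @sqnorm R))//.
rewrite deriveM; last 2 first.
- exact/diff_derivable/differentiable_coord3.
- exact/diff_derivable/(radial_differentiable hx).
by rewrite derive_coord (derive_radial _ hx) /GRing.scale/= addrC mulrC.
Qed.

Lemma partial_hedgehog (R : realType) (h : R -> R) (dh : R) (i : 'I_3)
    (x : space R) : is_derive (sqnorm x) 1 h dh ->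
  let d j := (i == j)%:R * h (sqnorm x) + coord j x * (2 * coord i x * dh) in
  partial i (hedgehog h) x =
    \col_k (if k == 0 then (d ord_max +i* 0)%C else (d ord0 +i* d (inord 1))%C).
Proof.
move=> hx d; apply/colP => k; rewrite !mxE.
have E j : d j = 'D_(basis3 R i) (fun y => coord j y * h (sqnorm y)) x.
  by rewrite (derive_coord_radial _ _ hx).
case: ifPn => k0.
- rewrite (_ : (fun y => complex.Re _) =
    (fun y => coord ord_max y * h (sqnorm y))); last first.
    by apply/funext => y; rewrite !mxE k0.
  rewrite (_ : (fun y => complex.Im _) = cst 0) ?derive_cst ?E//.
  by apply/funext => y; rewrite !mxE k0.
- rewrite (_ : (fun y => complex.Re _) =
    (fun y => coord ord0 y * h (sqnorm y))); last first.
    by apply/funext => y; rewrite !mxE (negbTE k0).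
  rewrite (_ : (fun y => complex.Im _) =
    (fun y => coord (inord 1) y * h (sqnorm y))) ?E//.
  by apply/funext => y; rewrite !mxE (negbTE k0).
Qed.

(** The Pauli relations give (sigma.p)(sigma.F) = -i (div F + i sigma.curl F), and the radial field
    F = x h(|x|^2) is curl free. Only the divergence 3 h + 2 s h' remains, in the first
    component. *)
Lemma sigma_p_hedgehog (R : realType) (h : R -> R) (dh : R) (x : space R) :
  is_derive (sqnorm x) 1 h dh ->
  sigma_p (hedgehog h) x =
    \col_k (if k == 0
            then (0 +i* - (3 * h (sqnorm x) + 2 * sqnorm x * dh))%C else 0).
Proof.
move=> hx; rewrite /sigma_p !big_ord_recl big_ord0 addr0.
rewrite !(partial_hedgehog _ hx).
apply/colP => k; rewrite !mxE !big_ord_recl !big_ord0 /= !mxE /=.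
rewrite /coord /= !inordK//= -!val_eqE /= !inordK//=.
case: k => [[|[|//]] k2] /=; apply/eqP; rewrite eq_complex /=;
  apply/andP; split; apply/eqP; rewrite /sqnorm.

all: ring.
Qed.

Lemma hedgehog_norm0 (R : realType) (h : R -> R) (x : space R) :
  h (sqnorm x) = 0 -> hedgehog h x = 0.
Proof.
by move=> hx; apply/colP => k; rewrite !mxE hx !mulr0; case: ifP.
Qed.

(** * Pointwise bounds for the amplitude and the divergence *)

Section amplitude_bounds.
Context (R : realType) (n : nat) (rho : R).
Hypotheses (n0 : (0 < n)%N) (rho0 : 0 < rho).
Implicit Types s : R.

Lemma cutoff_eq0 k s : rho ^+ 2 <= s -> cutoff k rho s = 0.
Proof.
move=> rs; rewrite /cutoff /flat ifF//; apply/negbTE; rewrite -leNgt subr_le0.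
by rewrite exprn_ege1// ler_pdivlMr ?mul1r// exprn_gt0.
Qed.

Lemma amplitude_eq0 s : rho ^+ 2 <= s -> amplitude n rho s = 0.
Proof. by move=> rs; rewrite /amplitude cutoff_eq0// !mulr0. Qed.

Lemma pole_ge0 s : 0 <= s -> 0 <= pole n s.
Proof. by move=> s0; rewrite invr_ge0 addr_ge0// exprn_ge0. Qed.

Lemma pole_le1 s : 0 <= s -> pole n s <= 1.
Proof.
by move=> s0; rewrite invf_le1 ?lerDl ?ltr_wpDr// ?exprn_ge0.
Qed.

Lemma pole_le s : 0 < s -> pole n s <= s ^- n.
Proof.
by move=> s0; rewrite lef_pV2 ?posrE ?exprn_gt0 ?ltr_wpDr ?exprn_ge0 ?lerDr// ltW.
Qed.

Lemma profile_ge0 s : 0 <= profile n s.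
Proof. exact: powR_ge0. Qed.

Lemma profile_le1 s : 0 <= s -> profile n s <= 1.
Proof.
move=> s0; rewrite -(powRr0 (1 + s ^+ n)); apply: ler_powR.
  by rewrite lerDl exprn_ge0.
by rewrite oppr_le0 divr_ge0// mulr_ge0.
Qed.

Let powR_exprn s : 0 <= s ->
  (s ^+ n) `^ (- (3 / (2 * n%:R))) = s `^ (- (3 / 2)).
Proof.
move=> s0; rewrite -powR_mulrn// -powRrM; congr (_ `^ _).
have nR : n%:R != 0 :> R by rewrite pnatr_eq0 -lt0n.
by field.
Qed.

Lemma profile_le s : 0 < s -> profile n s <= s `^ (- (3 / 2)).
Proof.
move=> s0; rewrite -powR_exprn ?(ltW s0)// /profile !powRN.
rewrite lef_pV2 ?posrE ?powR_gt0 ?exprn_gt0 ?ltr_wpDr ?exprn_ge0 ?(ltW s0)//.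
by apply: ge0_ler_powR; rewrite ?nnegrE ?lerDr ?addr_ge0 ?exprn_ge0 ?divr_ge0
  ?mulr_ge0 ?(ltW s0)//.
Qed.

(** For s >= 1 one has 1 + s^n <= 2 s^n; the price is a power of 2 that tends to 1 as n grows. *)
Lemma profile_ge s : 1 <= s ->
  2 `^ (- (3 / (2 * n%:R))) * s `^ (- (3 / 2)) <= profile n s.
Proof.
move=> s1; have s0 : 0 < s by rewrite (lt_le_trans _ s1).
rewrite -powR_exprn ?(ltW s0)// -powRM ?exprn_ge0 ?(ltW s0)// /profile !powRN.
rewrite lef_pV2 ?posrE ?powR_gt0 ?mulr_gt0 ?exprn_gt0 ?ltr_wpDr ?exprn_ge0 ?(ltW s0)//.
apply: ge0_ler_powR; rewrite ?nnegrE ?addr_ge0 ?mulr_ge0 ?exprn_ge0 ?divr_ge0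
  ?mulr_ge0// ?(ltW s0)//.
by rewrite mulr_natl mulr2n lerD2r exprn_ege1.
Qed.

Lemma cutoff0_le s : expR 1 * cutoff 0 rho s <= 1.
Proof.
rewrite /cutoff /flat; case: ifPn => [t0|_]; last by rewrite mulr0.
rewrite expr0 invr1 mul1r -expRD expR_le1 subr_le0.
by rewrite invf_ge1// lerBlDr lerDl sqr_ge0.
Qed.

Lemma cutoff2_le s : cutoff 2 rho s <= 6.
Proof.
rewrite /cutoff; have [t0|t0] := leP 0 (1 - (s / rho ^+ 2) ^+ 2); last first.
  by rewrite /flat ltNge (ltW t0).
(* The constant 6 is (2 + 0 + 1)!, and the argument of [flat] is at most 1. *)
rewrite (le_trans (flat_le 2 0 t0))// expr1 -[leRHS]mulr1 ler_wpM2l//.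
by rewrite lerBlDr lerDl sqr_ge0.
Qed.

Lemma cutoff_antitone s t : 0 <= s -> s <= t ->
  cutoff 0 rho t <= cutoff 0 rho s.
Proof.
move=> s0 st; rewrite /cutoff /flat.
have D : 1 - (t / rho ^+ 2) ^+ 2 <= 1 - (s / rho ^+ 2) ^+ 2.
  rewrite lerD2l lerN2 ler_sqr ?nnegrE ?divr_ge0 ?exprn_ge0 ?(ltW rho0)//.
    by rewrite ler_pM2r ?invr_gt0 ?exprn_gt0.
  exact: le_trans st.
case: ifPn => t0; last by rewrite -/(flat 0 _) flat_ge0.
have s0' := lt_le_trans t0 D.
by rewrite s0' !expr0 invr1 !mul1r ler_expR lerN2 lef_pV2.
Qed.

Lemma amplitude_ge s L : 1 <= s -> s <= L ->
  2 `^ (- (3 / (2 * n%:R))) * (expR 1 * cutoff 0 rho L) * s `^ (- (3 / 2)) <=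
  amplitude n rho s.
Proof.
move=> s1 sL; rewrite mulrAC /amplitude ler_pM ?mulr_ge0 ?powR_ge0 ?expR_ge0 ?flat_ge0//.
- exact: profile_ge.
- by rewrite ler_pM2l ?expR_gt0// cutoff_antitone// (le_trans _ s1).
Qed.

Definition amplitude' s : R :=
  profile n s * (expR 1 * (- (2 * s / rho ^+ 4) * cutoff 2 rho s)) +
  (expR 1 * cutoff 0 rho s) * - (3 / 2 * s ^+ n.-1 * (pole n s * profile n s)).

Lemma is_derive_amplitude s : 0 <= s ->
  is_derive s 1 (amplitude n rho) (amplitude' s).
Proof.
move=> s0; have dp := is_derive_profile n0 s0.
have dc := is_derive_cutoff 0 s (lt0r_neq0 rho0).
have dm := is_deriveM dp (is_deriveZ (expR 1) dc).
apply: (is_derive_eq dm).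
by rewrite /amplitude' /GRing.scale/= mul0r subr0.
Qed.

(* The main term tends to 3 on the unit ball and 0 outside; the other one comes
   from the cutoff. *)
Lemma divergenceE s : 0 <= s ->
  3 * amplitude n rho s + 2 * s * amplitude' s =
  3 * pole n s * profile n s * (expR 1 * cutoff 0 rho s) -
  4 * expR 1 * ((s / rho ^+ 2) ^+ 2 * profile n s) * cutoff 2 rho s.
Proof.
move=> s0; rewrite /amplitude /amplitude'.
(* That is, s^n / (1 + s^n) = 1 - [pole]. Hence the terms 3 and -3 s^n [pole], coming from h and
   from h', combine to 3 [pole]. *)
have P : pole n s = 1 - s * s ^+ n.-1 * pole n s.
  rewrite -exprS prednK// /pole; field.
  by rewrite lt0r_neq0// ltr_wpDr// exprn_ge0.
rewrite [in RHS]P; field; exact: lt0r_neq0.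
Qed.

(** By [profile_le] the left side is at most sqrt s / rho^4, and sqrt s <= rho on the support of the
    cutoff. *)
Lemma profile_tail s : 0 <= s -> s <= rho ^+ 2 ->
  (s / rho ^+ 2) ^+ 2 * profile n s <= rho ^- 3.
Proof.
rewrite le_eqVlt => /predU1P[<- _|s0 sr].
  by rewrite mul0r expr0n mul0r invr_ge0 exprn_ge0// ltW.
rewrite (le_trans (ler_wpM2l (sqr_ge0 _) (profile_le s0)))//.
have := ltW s0 => s0'.
have rE : s = Num.sqrt s ^+ 2 by rewrite sqr_sqrtr.
have r0 : 0 < Num.sqrt s by rewrite sqrtr_gt0.
have rr : Num.sqrt s <= rho by rewrite -ler_sqr ?nnegrE -?rE// ltW.
rewrite [X in X `^ _]rE -[X in X `^ _]powR_mulrn ?sqrtr_ge0// -powRrM.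
rewrite (_ : _ * - _ = - 3%:R); last by field.
rewrite powR_invn ?sqrtr_ge0// [X in X / _ ^+ 2]rE.
move: (Num.sqrt s : R) r0 rr => r r0 rr.
rewrite [leLHS](_ : _ = rho ^- 3 * (r / rho)); last by field; rewrite !gt_eqF.
rewrite ger_pMr ?invr_gt0 ?exprn_gt0//.
by rewrite ler_pdivrMr ?mul1r.
Qed.

Lemma divergence_le s : 0 <= s ->
  `|3 * amplitude n rho s + 2 * s * amplitude' s| <=
  3 * pole n s + 24 * expR 1 * rho ^- 3.
Proof.
move=> s0; have [rs|sr] := leP (rho ^+ 2) s.
  rewrite divergenceE// !cutoff_eq0// !mulr0 subr0 normr0.
  by rewrite addr_ge0 ?mulr_ge0 ?pole_ge0 ?expR_ge0 ?invr_ge0 ?exprn_ge0 ?(ltW rho0).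
rewrite divergenceE// (le_trans (ler_normB _ _))// lerD//.
  rewrite ger0_norm ?mulr_ge0 ?pole_ge0 ?profile_ge0 ?expR_ge0 ?flat_ge0//.
  rewrite -[leRHS]mulr1 ler_pM ?mulr_ge0 ?pole_ge0 ?profile_ge0 ?expR_ge0 ?flat_ge0
    ?cutoff0_le//.
  by rewrite -[leRHS]mulr1 ler_wpM2l ?mulr_ge0 ?pole_ge0 ?profile_le1.
rewrite ger0_norm; last first.
  by rewrite ?mulr_ge0 ?profile_ge0 ?expR_ge0 ?flat_ge0 ?invr_ge0 ?exprn_ge0 ?(ltW rho0).
(* Here 24 is the factor 4 of [divergenceE] times the bound 6 of [cutoff2_le]. *)
rewrite [leRHS](_ : _ = 4 * expR 1 * rho ^- 3 * 6); last by field; exact: lt0r_neq0.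
rewrite ler_pM ?mulr_ge0 ?profile_ge0 ?expR_ge0 ?flat_ge0 ?cutoff2_le
  ?invr_ge0 ?exprn_ge0 ?(ltW rho0)//.
by rewrite ler_wpM2l ?mulr_ge0 ?expR_ge0// profile_tail// ltW.
Qed.

Lemma divergence_eq0 s : rho ^+ 2 <= s ->
  3 * amplitude n rho s + 2 * s * amplitude' s = 0.
Proof.
move=> rs; rewrite divergenceE ?cutoff_eq0 ?mulr0 ?subr0//.
by rewrite (le_trans _ rs)// exprn_ge0// ltW.
Qed.

End amplitude_bounds.

(** * Hedgehogs as test spinors and their pointwise norms *)

Lemma smooth_hedgehog (R : realType) (h : R -> R) :
  (forall j, smooth (fun x : space R => coord j x * h (sqnorm x))) ->
  forall k, smooth (fun x => complex.Re (hedgehog h x k 0)) /\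
            smooth (fun x => complex.Im (hedgehog h x k 0)).
Proof.
move=> sh k; case: (eqVneq k 0) => k0; split.
- by rewrite (_ : (fun _ => _) = fun x => coord ord_max x * h (sqnorm x))//;
    apply/funext => x; rewrite !mxE k0.
- rewrite (_ : (fun _ => _) = cst 0); first exact: smooth_cst.
  by apply/funext => x; rewrite !mxE k0.
- by rewrite (_ : (fun _ => _) = fun x => coord ord0 x * h (sqnorm x))//;
    apply/funext => x; rewrite !mxE (negbTE k0).
- by rewrite (_ : (fun _ => _) = fun x => coord (inord 1) x * h (sqnorm x))//;
    apply/funext => x; rewrite !mxE (negbTE k0).
Qed.

Lemma coord_sq_le_sqnorm (R : realType) (x : space R) :
  [/\ x.1.1 ^+ 2 <= sqnorm x, x.1.2 ^+ 2 <= sqnorm x & x.2 ^+ 2 <= sqnorm x].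
Proof.
have := sqr_ge0 x.1.1; have := sqr_ge0 x.1.2; have := sqr_ge0 x.2.
by rewrite /sqnorm; split; lra.
Qed.

Lemma sqnorm_lt_box (R : realType) (r : R) (x : space R) : 0 <= r ->
  sqnorm x < r ^+ 2 -> (`[- r, r] `*` `[- r, r] `*` `[- r, r])%classic x.
Proof.
move=> r0 xr; have [h0 h1 h2] := coord_sq_le_sqnorm x.
have box (t : R) : t ^+ 2 <= sqnorm x -> t \in `[- r, r].
  move=> tx; rewrite in_itv/= -ler_norml -ler_sqr ?nnegrE// real_normK ?num_real//.
  exact: le_trans tx (ltW xr).
by split; [split|] => /=; exact: box.
Qed.

Lemma test_spinor_hedgehog (R : realType) (h : R -> R) (r : R) : 0 <= r ->
  (forall j, smooth (fun x : space R => coord j x * h (sqnorm x))) ->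
  (forall s, r ^+ 2 <= s -> h s = 0) -> test_spinor (hedgehog h).
Proof.
move=> r0 sh h0; split; first exact: smooth_hedgehog.
have cbox : compact (`[- r, r] `*` `[- r, r] `*` `[- r, r] : set (space R)).
  by apply: compact_setX; [apply: compact_setX|]; exact: segment_compact.
apply: (subclosed_compact _ cbox); first exact: closed_closure.
move/closure_id: (compact_closed (@norm_hausdorff _ _) cbox) => ->.
apply: closure_subset => x /= fx; apply: sqnorm_lt_box => //.
by rewrite ltNge; apply: contra_neqN fx => /h0; exact: hedgehog_norm0.
Qed.

(** The squared moduli of the two components add up to |x|^2 h^2, so the larger one is at least half
    of it; the other is dropped. This is the source of the factor 1 / sqrt 2. *)
Lemma norm_pow_hedgehog_ge (R : realType) (q : R) (h : R -> R) (x : space R) :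
  0 <= q ->
  (Num.sqrt (sqnorm x / 2) * `|h (sqnorm x)|) `^ q <= norm_pow q (hedgehog h x).
Proof.
move=> q0; rewrite /norm_pow !big_ord_recl big_ord0 addr0 !mxE/=.
rewrite -(sqrtr_sqr (h _)) -sqrtrM; last by rewrite divr_ge0 ?sqnorm_ge0.
set a := Num.sqrt (_ + 0 ^+ 2); set b := Num.sqrt (_ + _).
have ge c : sqnorm x / 2 * h (sqnorm x) ^+ 2 <= c ->
    Num.sqrt (sqnorm x / 2 * h (sqnorm x) ^+ 2) `^ q <= Num.sqrt c `^ q.
  by move=> /ler_wsqrtr sc; apply: ge0_ler_powR; rewrite ?nnegrE ?sqrtr_ge0.
have [xz|xz] := leP (sqnorm x / 2) (x.2 ^+ 2).
- apply: (@le_trans _ _ (a `^ q)); last by rewrite lerDl powR_ge0.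
  by apply: ge; rewrite expr0n addr0 exprMn ler_wpM2r ?sqr_ge0.
- apply: (@le_trans _ _ (b `^ q)); last by rewrite lerDr powR_ge0.
  apply: ge; rewrite !exprMn -mulrDl ler_wpM2r ?sqr_ge0// /coord/= inordK//=.
  by move: xz; rewrite /sqnorm; lra.
Qed.

(** The second component vanishes and contributes 0 because p is nonzero; at p = 0 it would count as
    1, by the convention for 0 to the power 0. *)
Lemma norm_pow_sigma_p_hedgehog (R : realType) (p : R) (h : R -> R) (dh : R)
    (x : space R) : p != 0 -> is_derive (sqnorm x) 1 h dh ->
  norm_pow p (sigma_p (hedgehog h) x) =
    `|3 * h (sqnorm x) + 2 * sqnorm x * dh| `^ p.
Proof.
move=> p0 hx; rewrite (sigma_p_hedgehog hx) /norm_pow !big_ord_recl big_ord0.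
rewrite !mxE/= expr0n/= !add0r sqrtr0 powR0// !addr0.
by rewrite sqrrN sqrtr_sqr.
Qed.

(** * Scaling of Lebesgue measure on the product *)

(** In other words, c times the pushforward of [m] along [phi] is [m]. In this form it can be
    checked on intervals by uniqueness of Lebesgue measure, and it passes to products. *)
Definition scales_measure d (T : measurableType d) (R : realType)
    (m : set T -> \bar R) (c : R) (phi : T -> T) : Prop :=
  measurable_fun setT phi /\
  forall A, measurable A -> (c%:E * m (phi @^-1` A))%E = m A.

Lemma scaled_pushforward d (T : measurableType d) (R : realType)
    (m : {measure set T -> \bar R}) (c : {nonneg R}) (phi : T -> T) :
  measurable_fun setT phi -> exists m' : {measure set T -> \bar R},
    forall A, m' A = (c%:num%:E * m (phi @^-1` A))%E.
Proof.
move=> mphi.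
by exists (mscale c
  (measure_function_pushforward__canonical__measure_function_Measure m mphi)).
Qed.

(** The product measure of X integrates the m2-measure of its sections against m1: the scaling of m2
    acts on each section, and that of m1 is a change of variables in the outer integral. *)
Lemma scales_product d1 d2 (T1 : measurableType d1) (T2 : measurableType d2)
    (R : realType) (m1 : {measure set T1 -> \bar R})
    (m2 : {sigma_finite_measure set T2 -> \bar R}) (c1 c2 : R)
    (phi1 : T1 -> T1) (phi2 : T2 -> T2) : 0 <= c1 -> 0 <= c2 ->
  scales_measure m1 c1 phi1 -> scales_measure m2 c2 phi2 ->
  scales_measure (m1 \x m2)%E (c1 * c2) (fun x => (phi1 x.1, phi2 x.2)).
Proof.
move=> c10 c20 [mphi1 s1] [mphi2 s2].
have mphi : measurable_fun setT (fun x : T1 * T2 => (phi1 x.1, phi2 x.2)).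
  by apply: measurable_fun_pair => /=; exact: measurableT_comp.
split=> // X mX.
have mphiX : measurable ((fun x : T1 * T2 => (phi1 x.1, phi2 x.2)) @^-1` X).
  by rewrite -[Y in measurable Y]setTI; exact: mphi.
have mX1 := measurable_fun_xsection m2 mX.
rewrite /product_measure1 EFinM -muleA -ge0_integralZl//; last first.
  exact: measurable_fun_xsection.
rewrite (eq_integral ((m2 \o xsection X) \o phi1)); last first.
  move=> x _ /=; rewrite -[RHS]s2; last exact: measurable_xsection.
  by congr (_ * m2 _)%E; apply/seteqP; split => y; rewrite /xsection/= !inE.
rewrite -[X in integral _ X _](preimage_setT phi1) -ge0_integral_pushforward//.
pose m1' := measure_function_pushforward__canonical__measure_function_Measure
  m1 mphi1.
rewrite -[_%:E]/((NngNum c10)%:num%:E) -(@ge0_integral_mscale _ _ _ m1')//.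
by apply: eq_measure_integral => A mA _; exact: s1.
Qed.

Lemma scales_lebesgue (R : realType) (l : R) : 0 < l ->
  scales_measure (@lebesgue_measure R) l
    ( *%R l : measurableTypeR R -> measurableTypeR R).
Proof.
move=> l0.
have ml : measurable_fun [set: measurableTypeR R]
    ( *%R l : measurableTypeR R -> measurableTypeR R).
  by apply: measurable_funM => //; exact: measurable_id.
split=> // A mA.
have [m mE] := scaled_pushforward (@lebesgue_measure R) (NngNum (ltW l0)) ml.
rewrite [RHS](@lebesgue_measure_unique _ m _ _ mA) ?mE// => _ [[a b]] _ <-.
rewrite mE /= (_ : _ @^-1` _ = `]a / l, b / l]%classic); last first.
  apply/seteqP; split => x /=; rewrite !in_itv/= ltr_pdivrMr// ler_pdivlMr//;
    by rewrite mulrC.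
rewrite !lebesgue_measure_itv/= !lte_fin ltr_pM2r ?invr_gt0//.
case: ifPn => _; last by rewrite mule0.
by rewrite -!EFinD -EFinM; congr (_%:E); field; exact: lt0r_neq0.
Qed.

Lemma scales_lebesgue3 (R : realType) (l : R) : 0 < l ->
  scales_measure (@lebesgue3 R) (l * l * l)
    (fun x => (l * x.1.1, l * x.1.2, l * x.2)).
Proof.
move=> l0; have sl := scales_lebesgue l0; have l0' := ltW l0.
have s2 := @scales_product _ _ _ _ R (@lebesgue_measure R) (@lebesgue_measure R)
  l l _ _ l0' l0' sl sl.
pose m2 : {measure set (measurableTypeR R * measurableTypeR R)%type -> \bar R} :=
  (@lebesgue_measure R \x @lebesgue_measure R)%E.
exact: (@scales_product _ _ _ _ R m2 (@lebesgue_measure R)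
  (l * l) l _ _ (mulr_ge0 l0' l0') l0' s2 sl).
Qed.

(** * Volumes of balls, and integrals bounded by step functions *)

Section le_integralT.
Import HBNNSimple.

(** The integral of a nonnegative function is a supremum over the simple functions below it, and
    this set grows with the function. Spinor densities can therefore be compared directly with step
    functions. *)
Lemma le_integralT d (T : measurableType d) (R : realType)
    (mu : {measure set T -> \bar R}) (f g : T -> \bar R) :
  (forall x, 0 <= f x)%E -> (forall x, f x <= g x)%E ->
  (\int[mu]_x f x <= \int[mu]_x g x)%E.
Proof.
move=> f0 fg; have g0 x : (0 <= g x)%E := le_trans (f0 x) (fg x).
rewrite !ge0_integralTE//; apply: ereal_sup_le => _ [h hf <-].
exists h => // x.
exact: le_trans (hf x) (fg x).
Qed.

End le_integralT.

Section ball_volume.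
Context (R : realType).
Local Notation mu := (@lebesgue3 R).
Implicit Types (r t l : R).

Definition ball3 r : set (space (measurableTypeR R)) :=
  [set x | sqnorm (x : space R) < r ^+ 2].

Definition ball_volume : R := fine (mu (ball3 1)).

Lemma measurable_sqnorm :
  measurable_fun [set: space (measurableTypeR R)]
    ((@sqnorm R) : space (measurableTypeR R) -> measurableTypeR R).
Proof.
have m1 : measurable_fun [set: space (measurableTypeR R)]
    (fun x => x.1.1 : measurableTypeR R).
  exact: measurableT_comp measurable_fst measurable_fst.
have m2 : measurable_fun [set: space (measurableTypeR R)]
    (fun x => x.1.2 : measurableTypeR R).
  exact: measurableT_comp measurable_snd measurable_fst.
have m3 : measurable_fun [set: space (measurableTypeR R)]
    (fun x => x.2 : measurableTypeR R) by exact: measurable_snd.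
by apply: measurable_funD; first apply: measurable_funD; exact: measurable_funX.
Qed.

Lemma measurable_ball3 r : measurable (ball3 r).
Proof.
have -> : ball3 r = (@sqnorm R : space (measurableTypeR R) -> measurableTypeR R)
    @^-1` `]-oo, r ^+ 2[.
  by apply/seteqP; split => x /=; rewrite in_itv.
rewrite -[X in measurable X]setTI; exact: measurable_sqnorm.
Qed.

Let box r : set (space (measurableTypeR R)) :=
  `[- r, r] `*` `[- r, r] `*` `[- r, r].

Let measurable_box r : measurable (box r).
Proof. by apply: measurableX; [apply: measurableX|]. Qed.

Let box_volume r : 0 < r -> mu (box r) = ((r *+ 2) ^+ 3)%:E.
Proof.
move=> r0.
transitivity ((@lebesgue_measure R \x @lebesgue_measure R)
  (`[(- r)%R, r]%classic `*` `[(- r)%R, r]%classic) *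
  @lebesgue_measure R `[(- r)%R, r]%classic)%E.
  by apply: product_measure1E => //; exact: measurableX.
have I : @lebesgue_measure R `[(- r)%R, r]%classic = (r *+ 2)%:E.
  by rewrite lebesgue_measure_itv/= lte_fin gtrN// -EFinD opprK mulr2n.
by rewrite product_measure1E//= I -!EFinM -mulrA.
Qed.

Lemma ball3_fin : mu (ball3 1) = ball_volume%:E.
Proof.
rewrite fineK// ge0_fin_numE ?measure_ge0//.
apply: (@le_lt_trans _ _ (mu (box 1))); last by rewrite box_volume// ltry.
apply: le_measure; rewrite ?inE//; first exact: measurable_ball3.
by move=> x; exact: sqnorm_lt_box.
Qed.

Lemma ball_volume_le8 : ball_volume <= 8.
Proof.
rewrite -lee_fin -ball3_fin.
apply: (@le_trans _ _ (mu (box 1))).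
  apply: le_measure; rewrite ?inE//; first exact: measurable_ball3.
  by move=> x; exact: sqnorm_lt_box.
by rewrite box_volume// lee_fin; lra.
Qed.

Lemma ball_volume_gt0 : 0 < ball_volume.
Proof.
(* The cube of half-side 1/2 lies in the open unit ball, since 3/4 < 1. *)
rewrite -lte_fin -ball3_fin; apply: (@lt_le_trans _ _ (mu (box 2^-1))).
  by rewrite box_volume// lte_fin exprn_gt0.
apply: le_measure; rewrite ?inE//; first exact: measurable_ball3.
move=> [[x y] z] [[]] /=; rewrite !in_itv/= -!ler_norml => hx hy hz.
have sq (t : R) : `|t| <= 2^-1 -> t ^+ 2 <= 4^-1.
  move=> ht; rewrite -real_normK ?num_real//.
  have := ler_pM (normr_ge0 _) (normr_ge0 _) ht ht; rewrite -expr2; lra.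
rewrite /ball3 /sqnorm /= expr1n.
have := sq _ hx; have := sq _ hy; have := sq _ hz; lra.
Qed.

Lemma ball3_volume r : 0 < r -> mu (ball3 r) = (ball_volume * r ^+ 3)%:E.
Proof.
move=> r0; have [_ /(_ _ (measurable_ball3 r))] := scales_lebesgue3 r0.
move <-; rewrite (_ : _ @^-1` _ = ball3 1).
  by rewrite ball3_fin -EFinM; congr (_%:E); ring.
apply/seteqP; rewrite /ball3 /sqnorm/= expr1n; split => x /=;
  by rewrite !exprMn -!mulrDr gtr_pMr ?exprn_gt0.
Qed.

Definition shell r t := ball3 t `\` ball3 r.

Lemma measurable_shell r t : measurable (shell r t).
Proof. by apply: measurableD; exact: measurable_ball3. Qed.

Lemma shell_volume r t : 0 < r -> r <= t ->
  mu (shell r t) = (ball_volume * (t ^+ 3 - r ^+ 3))%:E.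
Proof.
move=> r0 rt; have t0 := lt_le_trans r0 rt.
have brt : ball3 r `<=` ball3 t.
  move=> x /= xr; apply: (lt_le_trans xr).
  by rewrite ler_sqr ?nnegrE ?(ltW r0) ?(ltW t0).
rewrite /shell measureD; last 3 first.
- exact: measurable_ball3.
- exact: measurable_ball3.
- by apply: (le_lt_trans _ (ltry (ball_volume * t ^+ 3))); rewrite -ball3_volume.
rewrite (setIidr brt); rewrite [X in (X - _)%E]ball3_volume//.
by rewrite [X in (_ - X)%E]ball3_volume// -EFinB mulrBr.
Qed.

(** The majorant puts c2 on the whole ball of radius b, including its overlap with the first one. No
    order between a and b has to be imposed, and the excess is absorbed in an error that vanishes in
    the limit. *)
Lemma integral_le_two_balls (F : space (measurableTypeR R) -> R) (a b c1 c2 : R) :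
  0 < a -> 0 < b -> 0 <= c1 -> 0 <= c2 -> (forall x, 0 <= F x) ->
  (forall x, ball3 a x -> F x <= c1) ->
  (forall x, ~ ball3 a x -> ball3 b x -> F x <= c2) ->
  (forall x, ~ ball3 a x -> ~ ball3 b x -> F x = 0) ->
  (\int[mu]_x (F x)%:E <= (ball_volume * (c1 * a ^+ 3 + c2 * b ^+ 3))%:E)%E.
Proof.
move=> a0 b0 c10 c20 F0 Fa Fb F00.
pose g (x : space (measurableTypeR R)) : \bar R :=
  (c1%:E * (\1_(ball3 a) x)%:E + c2%:E * (\1_(ball3 b) x)%:E)%E.
apply: (@le_trans _ _ (\int[mu]_x g x)%E).
  apply: le_integralT => x; first by rewrite lee_fin.
  rewrite /g -!EFinM -EFinD lee_fin !indicE.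
  have [xa|xa] := pselect (ball3 a x); have [xb|xb] := pselect (ball3 b x).
  - by rewrite !mem_set// !mulr1 (le_trans (Fa _ xa))// lerDl.
  - by rewrite mem_set// memNset// mulr1 mulr0 addr0 Fa.
  - by rewrite memNset// mem_set// mulr1 mulr0 add0r Fb.
  - by rewrite !memNset// !mulr0 addr0 F00.
have mi r : measurable_fun setT (fun x => (\1_(ball3 r) x)%:E : \bar R).
  by apply/measurable_EFinP; apply: measurable_indic; exact: measurable_ball3.
rewrite /g ge0_integralD//; last 4 first.
- by move=> x _; rewrite mule_ge0// lee_fin.
- exact: measurable_funeM.
- by move=> x _; rewrite mule_ge0// lee_fin.
- exact: measurable_funeM.
have i r : (\int[mu]_x (\1_(ball3 r) x)%:E)%E = mu (ball3 r).
  by rewrite integral_indic ?setIT//; exact: measurable_ball3.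
rewrite !ge0_integralZl ?i//.
rewrite !ball3_volume// -!EFinM -EFinD lee_fin le_eqVlt.
by apply/orP; left; apply/eqP; ring.
Qed.

Lemma integral_ge_shells (F : space (measurableTypeR R) -> R) (l : R)
    (K : nat) (c : nat -> R) : 1 <= l -> (forall k, 0 <= c k) ->
  (forall x, 0 <= F x) ->
  (forall k x, (k < K)%N -> shell (l ^+ k) (l ^+ k.+1) x -> c k <= F x) ->
  ((ball_volume * (l ^+ 3 - 1) * \sum_(k < K) c k * (l ^+ k) ^+ 3)%:E <=
    \int[mu]_x (F x)%:E)%E.
Proof.
move=> l1 c0 F0 Fc; have l0 : 0 < l by exact: lt_le_trans l1.
pose S k := shell (l ^+ k) (l ^+ k.+1).
pose g (x : space (measurableTypeR R)) : \bar R :=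
  (\sum_(k < K) (c k)%:E * (\1_(S k) x)%:E)%E.
apply: (@le_trans _ _ (\int[mu]_x g x)%E); last first.
  apply: le_integralT => x.
    by apply: sume_ge0 => k _; rewrite mule_ge0// lee_fin c0.
  rewrite /g; under eq_bigr do rewrite -EFinM; rewrite sumEFin lee_fin.
  (* The shells are pairwise disjoint, so at most one term of the sum is nonzero at x. *)
  have [[k Sk]|nS] := pselect (exists k : 'I_K, S k x); last first.
    rewrite big1// => k _; rewrite indicE memNset ?mulr0// => Sk.
    by apply: nS; exists k.
  rewrite (bigD1 k)//= big1 ?addr0; last first.
    move=> j jk; rewrite indicE memNset ?mulr0// => Sj.
    case: Sk => /= ltk gek; case: Sj => /= ltj gej.
    have := jk; rewrite -val_eqE neq_ltn => /orP[] jk'.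
    - apply: gek; apply: (lt_le_trans ltj).
      by rewrite ler_sqr ?nnegrE ?exprn_ge0 ?(ltW l0)// ler_weXn2l.
    - apply: gej; apply: (lt_le_trans ltk).
      by rewrite ler_sqr ?nnegrE ?exprn_ge0 ?(ltW l0)// ler_weXn2l.
  by rewrite indicE mem_set// mulr1; apply: Fc.
have mS k : measurable (S k) by exact: measurable_shell.
rewrite /g ge0_integral_sum//; last 2 first.
- move=> k; apply: measurable_funeM; apply/measurable_EFinP.
  exact: measurable_indic.
- by move=> k x _; rewrite mule_ge0// lee_fin c0.
rewrite (eq_bigr (fun k : 'I_K =>
    (c k * (ball_volume * ((l ^+ k.+1) ^+ 3 - (l ^+ k) ^+ 3)))%:E)); last first.
  move=> k _; rewrite ge0_integralZl//; last 2 first.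
  - by apply/measurable_EFinP; exact: measurable_indic.
  - by rewrite lee_fin c0.
  rewrite integral_indic// setIT shell_volume ?exprn_gt0//.
  by rewrite ler_weXn2l.
rewrite sumEFin lee_fin mulr_sumr le_eqVlt; apply/orP; left; apply/eqP.
by apply: eq_bigr => k _; rewrite [l ^+ k.+1]exprS; ring.
Qed.

End ball_volume.

(** * The inequality for one choice of the parameters *)

Lemma sobolev_exponent_gt (R : realType) (p : R) : 1 < p -> p < 3 ->
  3 / 2 < sobolev_exponent p.
Proof.
by move=> p1 p3; rewrite /sobolev_exponent ltr_pdivlMr ?subr_gt0//; lra.
Qed.

Lemma sobolev_exponent_gt0 (R : realType) (p : R) : 1 < p -> p < 3 ->
  0 < sobolev_exponent p.
Proof.
by move=> p1 p3; rewrite (lt_trans _ (sobolev_exponent_gt p1 p3))// divr_gt0.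
Qed.

Lemma sobolev_exponentV (R : realType) (p : R) : 1 < p -> p < 3 ->
  1 / sobolev_exponent p = 1 / p - 1 / 3.
Proof.
move=> p1 p3; have p0 : p != 0 by rewrite gt_eqF// (lt_trans _ p1).
have p30 : 3 - p != 0 by rewrite subr_eq0 gt_eqF.
by rewrite /sobolev_exponent; field; rewrite p0 p30.
Qed.

Lemma geometric_sum (R : fieldType) (r : R) (K : nat) : r != 1 ->
  \sum_(k < K) r ^+ k = (1 - r ^+ K) / (1 - r).
Proof.
move=> r1; have r1' : 1 - r != 0 by rewrite subr_eq0 eq_sym.
apply: (mulIf r1'); rewrite divfK//.
have := subrXX 1 r K; rewrite expr1n => ->; rewrite mulrC; congr (_ * _).
by apply: eq_bigr => k _; rewrite expr1n mul1r.
Qed.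

(** Combines exp x >= 1 + x with ln l <= l - 1. It serves both the ratio of the geometric series and
    the power of 2 in [profile_ge]. *)
Lemma powR_ge1B (R : realType) (l a : R) : 1 <= l -> 0 <= a ->
  1 - a * (l - 1) <= l `^ (- a).
Proof.
move=> l1 a0; have l0 : 0 < l by exact: lt_le_trans l1.
rewrite /powR gt_eqF// mulNr (le_trans _ (expR_ge1Dx _))// lerD2l lerN2.
rewrite ler_wpM2l// -{1}(subrK 1 l) addrC le_ln1Dx//.
by rewrite ltrBrDl subrr.
Qed.

Lemma powR_lt1 (R : realType) (l a : R) : 1 < l -> a < 0 -> l `^ a < 1.
Proof.
move=> l1 a0; rewrite /powR gt_eqF; last exact: lt_trans l1.
by rewrite expR_lt1 pmulr_llt0 ?ln_gt0.
Qed.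

Section key_inequality.
Context (R : realType) (p C l rho : R) (n K : nat).
Hypotheses (p1 : 1 < p) (p3 : p < 3) (l1 : 1 < l) (rho0 : 0 < rho).
Hypotheses (n0 : (0 < n)%N) (K0 : (0 < K)%N).
Hypothesis cutoff_gt0 : 0 < cutoff 0 rho ((l ^+ K) ^+ 2).

Let q : R := sobolev_exponent p.
Let f := hedgehog (amplitude n rho).
Let l0 : 0 < l := lt_trans ltr01 l1.
Let q0 : 0 < q := sobolev_exponent_gt0 p1 p3.

(** For 1 <= |x| <= l^K the larger component of [f] has modulus at least [loss] / |x|^2; [loss]
    tends to 1 / sqrt 2 as rho and n grow. *)
Definition loss : R :=
  2 `^ (- (3 / (2 * n%:R))) * (expR 1 * cutoff 0 rho ((l ^+ K) ^+ 2)) /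
  Num.sqrt 2.

Definition tail : R := 24 * expR 1 * rho ^- 3.

Let loss_gt0 : 0 < loss.
Proof. by rewrite !mulr_gt0 ?powR_gt0 ?expR_gt0 ?invr_gt0 ?sqrtr_gt0. Qed.

Let tail_ge0 : 0 <= tail.
Proof. by rewrite !mulr_ge0 ?expR_ge0 ?invr_ge0 ?exprn_ge0 ?(ltW rho0). Qed.

Let test_f : test_spinor f.
Proof.
apply: (test_spinor_hedgehog (ltW rho0)).
  by move=> j; apply: smooth_coord_amplitude => //; exact: lt0r_neq0.
by move=> s; exact: amplitude_eq0.
Qed.

Let term k : (loss * (l ^+ k.+1) ^- 2) `^ q * (l ^+ k) ^+ 3 =
  loss `^ q * l `^ (- (2 * q)) * (l `^ (3 - 2 * q)) ^+ k.
Proof.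
have lk m : l ^+ m = l `^ m%:R by rewrite powR_mulrn// ltW.
rewrite powRM ?invr_ge0 ?exprn_ge0 ?(ltW l0) ?(ltW loss_gt0)//.
rewrite -!mulrA; congr (_ * _).
rewrite -[X in _ = _ * X]powR_mulrn ?powR_ge0// -!exprM !lk -powRN -!powRrM.
rewrite -!powRD ?(gt_eqF l0) ?implybT//; congr (_ `^ _).
by rewrite !natrM -natr1; ring.
Qed.

Let lower_bound :
  ((ball_volume R * (loss `^ q * l `^ (- (2 * q))) *
    ((1 - (l `^ (3 - 2 * q)) ^+ K) * (3 / (2 * q - 3))))%:E <=
   \int[@lebesgue3 R]_x (norm_pow q (f x))%:E)%E.
Proof.
have q32 : 0 < 2 * q - 3.
  have := sobolev_exponent_gt p1 p3; rewrite -/q ltr_pdivrMr//.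
  by rewrite mulrC subr_gt0.
set r := l `^ (3 - 2 * q).
have r0 : 0 <= r by exact: powR_ge0.
have r1 : r < 1.
  by apply: powR_lt1 => //; rewrite -oppr_gt0 opprB.
apply: (@le_trans _ _ (ball_volume R * (l ^+ 3 - 1) *
    \sum_(k < K) (loss * (l ^+ k.+1) ^- 2) `^ q * (l ^+ k) ^+ 3)%:E).
  rewrite lee_fin; under eq_bigr do rewrite term.
  rewrite -mulr_sumr geometric_sum ?lt_eqF//.
  rewrite -!mulrA ler_pM2l ?ball_volume_gt0//.
  rewrite [leRHS]mulrCA ler_pM2l ?powR_gt0//.
  rewrite [leRHS]mulrCA ler_pM2l ?powR_gt0//.
  rewrite [leRHS]mulrCA ler_wpM2l ?subr_ge0 ?exprn_ile1 ?(ltW r1)//.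
  rewrite ler_pdivrMr// mulrAC ler_pdivlMr ?subr_gt0//.
  (* The quotient (l^3 - 1) / (1 - r) is at least 3 / (2q - 3) for every l > 1: the numerator is at
     least 3 (l - 1), the denominator at most (2q - 3) (l - 1). *)
  have := powR_ge1B (ltW l1) (ltW q32).
  rewrite opprB -/r => h1.
  have h2 : 3 * (l - 1) <= l ^+ 3 - 1.
    rewrite -subr_ge0 (_ : _ - _ = (l - 1) ^+ 2 * (l + 2)); last by ring.
    by rewrite mulr_ge0 ?sqr_ge0// addr_ge0// ltW.
  rewrite (@le_trans _ _ (3 * ((2 * q - 3) * (l - 1))))//.
    by rewrite ler_wpM2l// lerBlDr -lerBlDl.
  by rewrite mulrCA mulrC ler_wpM2r// ltW.
apply: (@integral_ge_shells R (fun x => norm_pow q (f x)) l K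
  (fun k => (loss * (l ^+ k.+1) ^- 2) `^ q)) => [|k|x|k x kK xk].
- exact: ltW.
- exact: powR_ge0.
- by apply: sumr_ge0 => k _; exact: powR_ge0.
have [xlt xge] := xk; move/negP: xge; rewrite -leNgt => xge.
rewrite (le_trans _ (norm_pow_hedgehog_ge _ _ (ltW q0)))//.
have s1 : 1 <= sqnorm (x : space R).
  by rewrite (le_trans _ xge)// -exprM exprn_ege1// ltW.
have sL : sqnorm (x : space R) <= (l ^+ K) ^+ 2.
  rewrite ltW// (lt_le_trans xlt)// ler_sqr ?nnegrE ?exprn_ge0 ?(ltW l0)//.
  by rewrite ler_weXn2l// ltW.
have h := amplitude_ge n0 rho0 s1 sL.
have s0 : 0 < sqnorm (x : space R) by exact: lt_le_trans s1.
apply: ge0_ler_powR; rewrite ?nnegrE ?(ltW q0)//.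
  by rewrite mulr_ge0 ?(ltW loss_gt0)// invr_ge0 !exprn_ge0// ltW.
rewrite (le_trans _ (ler_wpM2l (sqrtr_ge0 _) (le_trans h (ler_norm _))))//.
have {}xlt : sqnorm (x : space R) < (l ^+ k.+1) ^+ 2 by [].
move: s0 (sqnorm_ge0 (x : space R)) xlt.
move: (sqnorm (x : space R)) => s s0 s0' slt.
rewrite sqrtrM// sqrtrV//.
rewrite (_ : s `^ (- (3 / 2)) = s ^-1 / Num.sqrt s); last first.
  rewrite -powR12_sqrt// -[s^-1]powR_inv1// -powRN -powRD ?(gt_eqF s0) ?implybT//.
  by congr (_ `^ _); field.
rewrite /loss; set A := 2 `^ _; set D := expR (1 : R) * _.
set s2 := Num.sqrt (2 : R).
have s20 : s2 != 0 by rewrite sqrtr_eq0 -ltNge.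
have ss0 : Num.sqrt s != 0 by rewrite sqrtr_eq0 -ltNge.
rewrite [leRHS](_ : _ = A * D / s2 * s^-1); last first.
  by field; rewrite ss0 s20 gt_eqF.
rewrite ler_wpM2l//; first exact: (ltW loss_gt0).
by rewrite lef_pV2 ?posrE ?exprn_gt0// ltW.
Qed.

(** The inner ball has radius l rather than 1: on the unit sphere [pole] equals 1/2 for every n,
    whereas beyond radius l it is at most l^(-2n). *)
Let upper_bound :
  (\int[@lebesgue3 R]_x (norm_pow p (sigma_p f x))%:E <=
   (ball_volume R * ((3 + tail) `^ p * l ^+ 3 +
     (3 * l ^- (2 * n) + tail) `^ p * rho ^+ 3))%:E)%E.
Proof.
have p0 : 0 < p by exact: lt_trans p1.
have E (x : space R) : norm_pow p (sigma_p f x) =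
    `|3 * amplitude n rho (sqnorm x) +
      2 * sqnorm x * amplitude' n rho (sqnorm x)| `^ p.
  apply: norm_pow_sigma_p_hedgehog; first exact: lt0r_neq0.
  exact: is_derive_amplitude (sqnorm_ge0 x).
have le (x : space R) c : 0 <= c -> pole n (sqnorm x) <= c ->
    norm_pow p (sigma_p f x) <= (3 * c + tail) `^ p.
  move=> c0 xc; rewrite E; apply: ge0_ler_powR; rewrite ?nnegrE ?(ltW p0)//.
    by rewrite addr_ge0// mulr_ge0.
  rewrite (le_trans (divergence_le n0 rho0 (sqnorm_ge0 x)))//.
  by rewrite lerD2r ler_wpM2l.
apply: integral_le_two_balls => //; rewrite ?powR_ge0//.
- by move=> x; rewrite E powR_ge0.
- move=> x _; rewrite -[in 3 + _](mulr1 3); apply: le => //.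
  exact: pole_le1 (sqnorm_ge0 _).
- move=> x /negP; rewrite -leNgt => xl _.
  have x0 : 0 < sqnorm (x : space R) by rewrite (lt_le_trans _ xl)// exprn_gt0.
  apply: le; first by rewrite invr_ge0 exprn_ge0// ltW.
  rewrite (le_trans (pole_le n x0))// lef_pV2 ?posrE ?exprn_gt0// exprM.
  by rewrite ler_pXn2r ?nnegrE ?exprn_ge0 ?(ltW l0) ?(ltW x0).
- move=> x _ /negP; rewrite -leNgt => xr.
  by rewrite E divergence_eq0// normr0 powR0// lt0r_neq0.
Qed.

Lemma key_inequality : dirac_sobolev p C ->
  (ball_volume R * (loss `^ q * l `^ (- (2 * q))) *
    ((1 - (l `^ (3 - 2 * q)) ^+ K) * (3 / (2 * q - 3)))) `^ (1 / q) <=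
  C * (ball_volume R * ((3 + tail) `^ p * l ^+ 3 +
     (3 * l ^- (2 * n) + tail) `^ p * rho ^+ 3)) `^ (1 / p).
Proof.
move=> /(_ f test_f); rewrite -/q => hC.
have p0 : 0 < p by exact: lt_trans p1.
have q32 : 0 < 2 * q - 3.
  have := sobolev_exponent_gt p1 p3; rewrite -/q ltr_pdivrMr//.
  by rewrite mulrC subr_gt0.
set S := (X in X `^ (1 / q)); set U := (X in _ * X `^ _).
have S0 : 0 < S.
  rewrite !mulr_gt0 ?ball_volume_gt0 ?powR_gt0 ?invr_gt0//.
  rewrite subr_gt0 exprn_ilt1 ?powR_ge0 -?lt0n//.
  by apply: powR_lt1 => //; rewrite -oppr_gt0 opprB.
have U0 : 0 <= U.
  rewrite mulr_ge0 ?(ltW (ball_volume_gt0 _))// addr_ge0// mulr_ge0 ?powR_ge0//.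
    by rewrite exprn_ge0// ltW.
  by rewrite exprn_ge0// ltW.
have SC : ((S `^ (1 / q))%:E <= C%:E *
    (\int[@lebesgue3 R]_x (norm_pow p (sigma_p f x))%:E) `^ (1 / p))%E.
  apply: le_trans hC; rewrite -poweR_EFin.
  have q10 : 0 <= 1 / q by rewrite div1r invr_ge0 ltW.
  apply: gt0_ler_poweR => //; rewrite ?in_itv/= ?leey ?andbT ?lee_fin ?(ltW S0)//.
  by apply: integral_ge0 => x _; rewrite lee_fin sumr_ge0// => k _; rewrite powR_ge0.
have I0 : (0 <= \int[@lebesgue3 R]_x (norm_pow p (sigma_p f x))%:E)%E.
  by apply: integral_ge0 => x _; rewrite lee_fin sumr_ge0// => k _; rewrite powR_ge0.
have C0 : 0 <= C.
  rewrite leNgt; apply/negP => C0.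
  have : ((S `^ (1 / q))%:E <= 0)%E.
    by apply: (le_trans SC); rewrite mule_le0_ge0 ?poweR_ge0// lee_fin ltW.
  by rewrite lee_fin leNgt powR_gt0.
rewrite -lee_fin; apply: (le_trans SC); rewrite EFinM lee_wpmul2l ?lee_fin//.
rewrite -poweR_EFin; apply: gt0_ler_poweR;
  rewrite ?in_itv/= ?leey ?andbT ?divr_ge0 ?lee_fin ?(ltW p0)//.
Qed.

End key_inequality.

Lemma cvg_powR (R : realType) (T : Type) (F : set_system T) (FF : Filter F)
    (f : T -> R) (a c : R) : 0 < a -> f @ F --> a ->
  f x `^ c @[x --> F] --> a `^ c.
Proof.
move=> a0 fa.
have powR_cont : {for a, continuous (fun z : R => z `^ c)}.
  apply/differentiable_continuous/derivable1_diffP.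
  by have [] := is_derive1_powR c a0.
exact: (continuous_cvg FF powR_cont fa).
Qed.

Lemma flat_continuous (R : realType) (k : nat) : continuous (@flat R k).
Proof.
move=> t; apply/differentiable_continuous/derivable1_diffP.
by have [] := is_derive_flat k t.
Qed.

(** * Choice of the parameters *)

Section parameters.
Context (R : realType) (p C e : R).
Hypotheses (p1 : 1 < p) (p3 : p < 3) (e0 : 0 < e) (e1 : e < 1).

Let q : R := sobolev_exponent p.
Let l : R := 1 + e.
Let l1 : 1 < l. Proof. by rewrite ltrDl. Qed.
Let l0 : 0 < l := lt_trans ltr01 l1.
Let p0 : 0 < p := lt_trans ltr01 p1.
Let q0 : 0 < q := sobolev_exponent_gt0 p1 p3.

Let q32 : 0 < 2 * q - 3.
Proof.
have := sobolev_exponent_gt p1 p3; rewrite -/q ltr_pdivrMr//.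
by rewrite mulrC subr_gt0.
Qed.

Let ex_K : exists2 K : nat, (0 < K)%N & (l `^ (3 - 2 * q)) ^+ K <= e.
Proof.
have r1 : `|l `^ (3 - 2 * q)| < 1.
  by rewrite ger0_norm ?powR_ge0// powR_lt1// -oppr_gt0 opprB.
suff : \forall K \near \oo, (0 < K)%N /\ (l `^ (3 - 2 * q)) ^+ K <= e.
  by move=> [N _ /(_ N (leqnn N)) [? ?]]; exists N.
near=> K; split; first by near: K; exact: nbhs_infty_gt.
near: K; exact: (cvgr_le _ (cvg_expr r1) _ e0).
Unshelve. all: by end_near. Qed.

(** The last condition anticipates [ex_n]: once 3 l^(-2n) <= rho^-3, the outer density is at most
    ((1 + 24 exp 1) rho^-3)^p, and multiplying by rho^3 leaves a multiple of rho^(3 - 3p). *)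
Let ex_rho (L : R) : exists rho : R, [/\ 0 < rho,
  1 - e <= expR 1 * cutoff 0 rho L, tail rho <= e &
  (1 + 24 * expR 1) `^ p * (rho^-1) `^ (3 * p - 3) <= e].
Proof.
(* With u = 1 / rho the four conditions become limits at 0 from the right. *)
suff : \forall u \near (0 : R)^'+, [/\ 0 < u,
    1 - e <= expR 1 * flat 0 (1 - (L * u ^+ 2) ^+ 2),
    24 * expR 1 * u ^+ 3 <= e &
    (1 + 24 * expR 1) `^ p * u `^ (3 * p - 3) <= e].
  move=> /filter_ex[u [u0 h1 h2 h3]]; exists u^-1; split.
  - by rewrite invr_gt0.
  - by rewrite /cutoff exprVn invrK.
  - by rewrite /tail exprVn invrK.
  - by rewrite invrK.
have id0 : (u : R) @[u --> (0 : R)^'+] --> (0 : R).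
  by apply: cvg_at_right_filter; exact: cvg_id.
near=> u; split.
- by near: u; exact: nbhs_right_gt.
- near: u; apply: (cvgr_ge 1); last by rewrite gtrBl.
  rewrite -[X in _ --> X](expRxMexpNx_1 1).
  apply: cvgMr; rewrite (_ : expR (-1) = flat 0 (1 - (L * 0 ^+ 2) ^+ 2)); last first.
    rewrite /flat expr0n mulr0 expr0n subr0 ltr01 expr0 invr1 mul1r.
    by [].
  apply: (continuous_cvg _ (@flat_continuous R 0 _)).
  apply: cvgB; first exact: cvg_cst.
  have h : L * u ^+ 2 @[u --> (0 : R)^'+] --> L * 0 ^+ 2.
    by apply: cvgMr; rewrite expr2; apply: cvgM.
  by rewrite !expr2; exact: cvgM.
- near: u; apply: (cvgr_le 0) => //.
  rewrite -[X in _ --> X](mulr0 (24 * expR 1)).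
  apply: cvgMr; rewrite -[X in _ --> X](mulr0 0); apply: cvgM => //.
  by rewrite -[X in _ --> X](mulr0 0); apply: cvgM.
- near: u; apply: (cvgr_le 0) => //.
  rewrite -[X in _ --> X](mulr0 ((1 + 24 * expR 1) `^ p)).
  apply: cvgMr; apply: powR_cvg0.
  by rewrite subr_gt0 ltr_pMr.
Unshelve. all: by end_near. Qed.

Let ex_n (rho : R) : 0 < rho -> exists2 n : nat, (0 < n)%N &
  1 - e <= 2 `^ (- (3 / (2 * n%:R))) /\ 3 * l ^- (2 * n) <= rho ^- 3.
Proof.
move=> rho0; suff : \forall n \near \oo, [/\ (0 < n)%N,
    3 / (2 * n%:R) <= e & 3 * l ^- (2 * n) <= rho ^- 3].
  move=> [N _ /(_ N (leqnn N)) [N0 h1 h2]]; exists N => //; split=> //.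
  have N30 : 0 <= 3 / (2 * N%:R) :> R by rewrite divr_ge0// mulr_ge0.
  have := @powR_ge1B R 2 _ (ler1n _ 2) N30.
  rewrite (_ : 2 - 1 = 1 :> R); last by ring.
  by rewrite mulr1; apply: le_trans; rewrite lerD2l lerN2.
have lV : `|l^-1| < 1.
  by rewrite ger0_norm ?invr_ge0 ?(ltW l0)// invf_lt1.
near=> n; have n0 : (0 < n)%N by near: n; exact: nbhs_infty_gt.
have nR : 0 < n%:R :> R by rewrite ltr0n.
split=> //.
  rewrite ler_pdivrMr ?mulr_gt0// -ler_pdivrMl// -ler_pdivrMl//.
  near: n; exact: nbhs_infty_ger.
rewrite -ler_pdivlMl// (@le_trans _ _ (l^-1 ^+ n))//.
  rewrite mulnC exprM -!exprVn [leRHS](_ : _ = (l^-1 ^+ n) ^+ 1)//.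
  apply: ler_wiXn2l => //.
    by rewrite exprn_ge0// invr_ge0 ltW.
  by rewrite exprn_ile1// ?invr_ge0 ?(ltW l0)// invf_le1// ltW.
near: n; apply: (cvgr_le _ (cvg_expr lV)).
by rewrite mulr_gt0// invr_gt0// exprn_gt0.
Unshelve. all: by end_near. Qed.

(** The single number e controls every error, with l = 1 + e. The order of choice is forced: K makes
    the geometric series nearly complete, rho must be large compared with l^K for the cutoff to be
    nearly 1 on the shells, and n must make [pole] small against rho^-3. *)
Lemma approximate_inequality : dirac_sobolev p C ->
  0 <= C /\
  (ball_volume R * (((1 - e) * (1 - e) / Num.sqrt 2) `^ q * l `^ (- (2 * q))) *
    ((1 - e) * (3 / (2 * q - 3)))) `^ (1 / q) <=
  C * (ball_volume R * ((3 + e) `^ p * l ^+ 3 + e)) `^ (1 / p).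
Proof.
move=> hC; have [K K0 Ke] := ex_K.
have [rho [rho0 cut_ge tail_le rhoe]] := ex_rho ((l ^+ K) ^+ 2).
have [n n0 [ne nrho]] := ex_n rho0.
have e10 : 0 < 1 - e by rewrite subr_gt0.
have cut0 : 0 < cutoff 0 rho ((l ^+ K) ^+ 2).
  by rewrite -(pmulr_rgt0 _ (expR_gt0 1)) (lt_le_trans _ cut_ge).
have tail0 : 0 <= tail rho.
  by rewrite !mulr_ge0 ?expR_ge0 ?invr_ge0 ?exprn_ge0 ?(ltW rho0).
have V0 := ball_volume_gt0 R.
have rV0 : 0 < rho^-1 by rewrite invr_gt0.
have key := key_inequality p1 p3 l1 rho0 n0 K0 cut0 hC.
rewrite -/q in key.
move: key; set S' := (X in X `^ (1 / q) <= _).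
set U' := (X in _ <= _ * X `^ _) => key.
pose S := ball_volume R *
  (((1 - e) * (1 - e) / Num.sqrt 2) `^ q * l `^ (- (2 * q))) *
  ((1 - e) * (3 / (2 * q - 3))).
pose U := ball_volume R * ((3 + e) `^ p * l ^+ 3 + e).
rewrite -/S -/U.
have q10 : 0 <= 1 / q by rewrite div1r invr_ge0 ltW.
have p10 : 0 <= 1 / p by rewrite div1r invr_ge0 ltW.
have s20 : 0 < Num.sqrt 2 :> R by rewrite sqrtr_gt0.
have S0 : 0 < S.
  by rewrite !mulr_gt0 ?powR_gt0 ?mulr_gt0 ?invr_gt0.
have SS' : S <= S'.
  rewrite /S /S' -!mulrA ler_pM2l//.
  apply: ler_pM; rewrite ?powR_ge0//.
  - by rewrite !mulr_ge0 ?powR_ge0 ?(ltW e10) ?invr_ge0 ?(ltW q32).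
  - apply: ge0_ler_powR; rewrite ?nnegrE ?(ltW q0)//.
    + by rewrite !mulr_ge0 ?(ltW e10) ?invr_ge0 ?(ltW s20).
    + by rewrite !mulr_ge0 ?powR_ge0 ?expR_ge0 ?(ltW cut0) ?invr_ge0 ?(ltW s20).
    + rewrite /loss !mulrA ler_pM2r ?invr_gt0// -[leRHS]mulrA.
      by apply: ler_pM; rewrite ?(ltW e10).
  - rewrite ler_pM2l ?powR_gt0// ler_pM2r ?divr_gt0//.
    by rewrite lerD2l lerN2.
have UU' : U' <= U.
  rewrite ler_pM2l// lerD//.
    rewrite ler_pM2r ?exprn_gt0//.
    apply: ge0_ler_powR; rewrite ?nnegrE ?addr_ge0 ?(ltW p0) ?(ltW e0)//.
    by rewrite lerD2l.
  apply: le_trans rhoe.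
  rewrite [leRHS](_ : _ = ((1 + 24 * expR 1) * rho ^- 3) `^ p * rho ^+ 3).
    rewrite ler_pM2r ?exprn_gt0//.
    apply: ge0_ler_powR; rewrite ?nnegrE ?(ltW p0)//.
    - by rewrite addr_ge0// mulr_ge0// invr_ge0 exprn_ge0// ltW.
    - by rewrite mulr_ge0 ?addr_ge0 ?mulr_ge0 ?expR_ge0 ?invr_ge0 ?exprn_ge0 ?(ltW rho0).
    by rewrite [leRHS]mulrDl mul1r lerD.
  rewrite powRM ?addr_ge0 ?mulr_ge0 ?expR_ge0 ?invr_ge0 ?exprn_ge0 ?(ltW rho0)//.
  rewrite -[RHS]mulrA; congr (_ * _).
  rewrite powRD ?(gt_eqF rV0) ?implybT// powRrM powR_mulrn ?(ltW rV0)// exprVn.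
  by rewrite powRN powR_mulrn ?(ltW rV0)// exprVn invrK.
have U'0 : 0 <= U'.
  rewrite mulr_ge0 ?(ltW V0)// addr_ge0// mulr_ge0 ?powR_ge0// exprn_ge0// ltW//.
have U0 : 0 <= U by exact: le_trans UU'.
have {}key : S `^ (1 / q) <= C * U' `^ (1 / p).
  apply: le_trans key; apply: ge0_ler_powR; rewrite ?nnegrE ?(ltW S0)//.
  by rewrite (le_trans (ltW S0)).
have C0 : 0 <= C.
  rewrite leNgt; apply/negP => C0.
  have := le_trans key (mulr_le0_ge0 (ltW C0) (powR_ge0 _ _)).
  by rewrite leNgt powR_gt0.
split=> //; apply: (le_trans key); rewrite ler_wpM2l//.
by apply: ge0_ler_powR; rewrite ?nnegrE.
Qed.

End parameters.

(** * Numerical estimates for pi and logarithms *)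

Lemma sin_le_id (R : realType) (x : R) : 0 <= x -> sin x <= x.
Proof.
move=> x0.
have sin_cont : {within `[0, x], continuous (@sin R)}.
  by apply: continuous_subspaceT; exact: continuous_sin.
have [c _] := MVT_segment x0 (fun y _ => is_derive_sin y) sin_cont.
rewrite sin0 !subr0 => ->.
by rewrite -[leRHS]mul1r ler_wpM2r// cos_le1.
Qed.

(* sin (pi / 6) = 1 / 2 by the triple angle formula, and sin x <= x. *)
Lemma pi_ge3 (R : realType) : 3 <= pi :> R.
Proof.
set t : R := pi / 6; have pi0 := pi_gt0 R.
have t0 : 0 < t by rewrite divr_gt0.
have s0 : 0 < sin t.
  by apply: sin_gt0_pi; rewrite t0 /t ltr_pdivrMr// ltr_pMr// ltr1n.
have E : sin (t *+ 2 + t) = 1.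
  by rewrite -(sin_pihalf R); congr sin; rewrite /t mulr2n; field.
have := cos2Dsin2 t; move: E; rewrite sinD sin_mulr2n cos_mulr2n !mulr2n => E E2.
(* With 3t = pi/2 the triple angle formula reads 4 s^3 - 3 s + 1 = 0 for s = sin t, which factors in
   this way. *)
have E3 : (sin t + 1) * (2 * sin t - 1) ^+ 2 = 0.
  have c2 : cos t ^+ 2 = 1 - sin t ^+ 2 by rewrite -E2; ring.
  have : 3 * sin t * cos t ^+ 2 + (cos t ^+ 2 - 1) * sin t = 1.
    by rewrite -[RHS]E; ring.
  by rewrite c2 => /eqP; rewrite eq_sym -subr_eq0 => /eqP <-; ring.
have s12 : sin t = 2^-1.
  have sn1 : sin t + 1 != 0 by rewrite gt_eqF// addr_gt0.
  move/eqP: E3; rewrite mulf_eq0 (negbTE sn1)/= sqrf_eq0 subr_eq0 => /eqP s2.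
  by apply: (@mulfI _ 2) => //; rewrite s2 divff.
have := sin_le_id (ltW t0); rewrite s12 /t ler_pdivlMr//; lra.
Qed.

(** Equivalent to exp(-2/3) >= 1/2. The bound exp x >= 1 + x is too weak at -2/3, but at -1/15 it
    gives 14/15, whose tenth power is just above 1/2. The squares are rounded down to four
    decimals. *)
Lemma ln2_ge (R : realType) : 2 / 3 <= ln 2 :> R.
Proof.
rewrite -ler_expR lnK ?posrE// -[leRHS]invrK -[leLHS]invrK -expRN.
rewrite lef_pV2 ?posrE ?expR_gt0//.
rewrite (_ : - (2 / 3) = 10%:R * - 15^-1); last by field.
rewrite expRM_natl.
set a := expR _.
have a1 : 14 / 15 <= a by apply: le_trans (expR_ge1Dx _); lra.
have sq (b c : R) : 0 <= b -> b <= c -> b ^+ 2 <= c ^+ 2.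
  by move=> b0 bc; rewrite ler_sqr// nnegrE// (le_trans b0).
have a2 : 8711 / 10000 <= a ^+ 2.
  by apply: le_trans (sq _ _ _ a1); lra.
have a4 : 7588 / 10000 <= (a ^+ 2) ^+ 2.
  by apply: le_trans (sq _ _ _ a2); lra.
have a8 : 5757 / 10000 <= ((a ^+ 2) ^+ 2) ^+ 2.
  by apply: le_trans (sq _ _ _ a4); lra.
rewrite -!exprM in a8; rewrite [a ^+ 10](exprD a 8 2).
by move: (a ^+ (2 * 2 * 2)%N) (a ^+ 2) a8 a2 => b c hb hc; nra.
Qed.

Lemma ln2_le1 (R : realType) : ln 2 <= 1 :> R.
Proof. have h : -1 < 1 :> R by lra. exact: le_ln1Dx h. Qed.

Lemma ln_le_subr1 (R : realType) (x : R) : 0 < x -> ln x <= x - 1.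
Proof.
move=> x0; rewrite -{1}(subrK 1 x) addrC le_ln1Dx//.
by rewrite ltrBrDl subrr.
Qed.

(* One third of this expression is what remains of the logarithm of the quotient
   of the two constants when y = 3 / p - 1 and pi is replaced by 3. *)
Lemma slack_ge0 (R : realType) (y : R) : 0 < y -> y < 3 ->
  0 <= y * ln y + (y + 1) * (ln 2 - ln (3 - y)) + 3 / 2 * ln 2.
Proof.
move=> y0 y3.
(* From ln t <= t - 1 at t = 1 / (2y), together with ln 2 <= 1. *)
have h1 : - 2^-1 <= y * ln y.
  have y2 : 0 < (2 * y)^-1 by rewrite invr_gt0 mulr_gt0.
  have := ln_le_subr1 y2; rewrite lnV ?posrE ?mulr_gt0// lnM ?posrE//.
  move=> /(ler_wpM2l (ltW y0)).
  have -> : y * ((2 * y)^-1 - 1) = 2^-1 - y by field; rewrite gt_eqF.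
  have := ler_wpM2l (ltW y0) (@ln2_le1 R).
  by rewrite mulr1 mulrN mulrDr; lra.
(* From ln t <= t - 1 at t = (3 - y) / 2. *)
have h2 : (y + 1) * (ln (3 - y) - ln 2) <= (1 - y ^+ 2) / 2.
  have y3' : 0 < (3 - y) / 2 by rewrite divr_gt0// subr_gt0.
  have := ln_le_subr1 y3'; rewrite ln_div ?posrE ?subr_gt0//.
  have y1 : 0 <= y + 1 by rewrite addr_ge0// ltW.
  move=> /(ler_wpM2l y1) /le_trans; apply.
  by rewrite le_eqVlt; apply/orP; left; apply/eqP; field.
(* The two bounds leave y^2 / 2 - 1, and 3/2 ln 2 >= 1 compensates the -1; this is where the value
   2/3 comes from. *)
have := @ln2_ge R; have := sqr_ge0 y.
rewrite -opprB mulrN in h2 *.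
move: (y ^+ 2) (y * ln y) h1 h2 => a b h1 h2; lra.
Qed.

(** * Passage to the limit and comparison of the constants *)

Lemma limit_inequality (R : realType) (p C : R) (q := sobolev_exponent p) :
  1 < p -> p < 3 -> dirac_sobolev p C ->
  (ball_volume R * ((Num.sqrt 2)^-1 `^ q) * (3 / (2 * q - 3))) `^ (1 / q) <=
  C * (ball_volume R * 3 `^ p) `^ (1 / p).
Proof.
move=> p1 p3 hC; have V0 := ball_volume_gt0 R.
have q0 : 0 < q := sobolev_exponent_gt0 p1 p3.
have q32 : 0 < 2 * q - 3.
  have := sobolev_exponent_gt p1 p3; rewrite -/q ltr_pdivrMr//.
  by rewrite mulrC subr_gt0.
have s20 : 0 < Num.sqrt 2 :> R by rewrite sqrtr_gt0.
pose F := (0 : R)^'+.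
have FF : ProperFilter F by exact: at_right_proper_filter.
have id0 : (e : R) @[e --> F] --> (0 : R).
  by apply: cvg_at_right_filter; exact: cvg_id.
have cB : 1 - e @[e --> F] --> (1 : R).
  by rewrite -[X in _ --> X]subr0; apply: cvgB => //; exact: cvg_cst.
have cD (a : R) : a + e @[e --> F] --> a.
  by rewrite -[X in _ --> X]addr0; apply: cvgD => //; exact: cvg_cst.
pose S e := ball_volume R *
  (((1 - e) * (1 - e) / Num.sqrt 2) `^ q * (1 + e) `^ (- (2 * q))) *
  ((1 - e) * (3 / (2 * q - 3))).
pose U e := ball_volume R * ((3 + e) `^ p * (1 + e) ^+ 3 + e).
have cS : S e @[e --> F] -->
    ball_volume R * ((Num.sqrt 2)^-1 `^ q) * (3 / (2 * q - 3)).
  rewrite -[X in _ * X](mul1r (3 / _)); apply: cvgM; last exact: cvgMl.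
  apply: cvgMr; rewrite -[X in _ --> X]mulr1; apply: cvgM.
    apply: cvg_powR; first by rewrite invr_gt0.
    rewrite -[X in _ --> X]mul1r; apply: cvgMl.
    by rewrite -[X in _ --> X](mulr1 1); exact: cvgM.
  have := @cvg_powR R R F _ (fun e => 1 + e) 1 (- (2 * q)) ltr01 (cD 1).
  by rewrite powR1; apply; exact: FF.
have cU : U e @[e --> F] --> ball_volume R * 3 `^ p.
  apply: cvgMr; rewrite -[X in _ --> X]addr0; apply: cvgD => //.
  rewrite -[X in _ --> X]mulr1; apply: cvgM; first exact: cvg_powR.
  rewrite -[X in _ --> X](mulr1 1) -[X in _ * X](mulr1 1).
  under eq_fun do rewrite exprS expr2.
  by apply: cvgM => //; apply: cvgM.
apply: (@ler_cvg_to _ F _ _ (fun e => S e `^ (1 / q))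
  (fun e => C * U e `^ (1 / p))).
- by apply: cvg_powR cS; rewrite !mulr_gt0 ?powR_gt0 ?invr_gt0.
- by apply: cvgMr; apply: cvg_powR cU; rewrite mulr_gt0 ?powR_gt0.
near=> e.
have e0 : 0 < e by near: e; exact: nbhs_right_gt.
have e1 : e < 1 by near: e; exact: nbhs_right_lt.
by have [_] := approximate_inequality p1 p3 e0 e1 hC.
Unshelve. all: by end_near. Qed.

Lemma dirac_sobolev_ge (R : realType) (p C : R) : 1 < p -> p < 3 ->
  dirac_sobolev p C ->
  ((3 - p) / (3 * (p - 1))) `^ (1 / p - 1 / 3) <= 6 * Num.sqrt 2 * C.
Proof.
move=> p1 p3 hC; have V0 := ball_volume_gt0 R.
have p0 : 0 < p by exact: lt_trans p1.
(* Only the sign of [C] is extracted from this instance, so any e in ]0, 1[ would do. *)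
have h0 : 0 < 2^-1 :> R by rewrite invr_gt0.
have h1 : 2^-1 < 1 :> R by rewrite invf_lt1// ltr1n.
have [C0 _] := approximate_inequality p1 p3 h0 h1 hC.
have := limit_inequality p1 p3 hC.
have q0 := sobolev_exponent_gt0 p1 p3.
have q32 : 3 / (2 * sobolev_exponent p - 3) = (3 - p) / (3 * (p - 1)).
  have p30 : 3 - p != 0 by rewrite subr_eq0 gt_eqF.
  have p10 : p - 1 != 0 by rewrite subr_eq0 gt_eqF.
  rewrite /sobolev_exponent; field.
  rewrite p30 p10 (_ : _ + _ = 9 * (p - 1)) ?mulf_neq0//; by ring.
rewrite q32; set b := _ / (3 * _); set q := sobolev_exponent p.
have b0 : 0 < b by rewrite divr_gt0 ?mulr_gt0 ?subr_gt0.
have s20 : 0 < Num.sqrt 2 :> R by rewrite sqrtr_gt0.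
have s2V : 0 < (Num.sqrt 2)^-1 :> R by rewrite invr_gt0.
have A0 : 0 <= ball_volume R * (Num.sqrt 2)^-1 `^ q.
  by rewrite mulr_ge0 ?powR_ge0 ?(ltW V0).
rewrite (powRM _ A0 (ltW b0)).
rewrite powRM ?powR_ge0 ?(ltW V0)// -powRrM.
rewrite [q * _]mulrC divfK ?gt_eqF// powRr1 ?(ltW s2V)//.
rewrite [in leRHS]powRM ?powR_ge0 ?(ltW V0)// -powRrM.
rewrite [p * _]mulrC divfK ?gt_eqF// powRr1// sobolev_exponentV//.
(* The first factor is V^(1/q), which also stands on the left and cancels. *)
have -> : ball_volume R `^ (1 / p) =
    ball_volume R `^ (1 / p - 1 / 3) * ball_volume R `^ (1 / 3).
  by rewrite -powRD ?subrK// (gt_eqF V0) implybT.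
move=> h.
have V2 : ball_volume R `^ (1 / 3) <= 2.
  rewrite (_ : 2 = (8 : R) `^ (1 / 3)).
    by apply: ge0_ler_powR; rewrite ?nnegrE ?divr_ge0 ?ball_volume_le8 ?(ltW V0).
  rewrite (_ : 8 = (2 : R) `^ 3); last by rewrite powR_mulrn//; ring.
  by rewrite -powRrM (_ : 3 * (1 / 3) = 1) ?powRr1//; field.
set W := ball_volume R `^ (1 / p - 1 / 3) in h *.
have W0 : 0 < W by rewrite powR_gt0.
move: h; set B := b `^ _; set V3 := ball_volume R `^ (1 / 3) in V2 *.
rewrite -!mulrA ![C * _]mulrCA ler_pM2l// ler_pdivrMl// => h.
apply: (le_trans h).
rewrite (_ : 6 * _ = Num.sqrt 2 * (C * (2 * 3))); last by ring.
by rewrite ler_pM2l// mulrCA ler_wpM2l// ler_wpM2r.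
Qed.

Lemma paper_bound_le (R : realType) (p : R) : 1 < p -> p < 3 ->
  6 * Num.sqrt 2 *
  (pi `^ (- (1 / 3)) * 2 `^ (- 2 - 1 / p) * 3 `^ (- (1 / 3) - 1 / p) *
    (p `^ (- (1 / 3)) * (4 * p - 3) `^ (1 / p) /
     (p - 1) `^ (1 / p - 1 / 3))) <=
  ((3 - p) / (3 * (p - 1))) `^ (1 / p - 1 / 3).
Proof.
move=> p1 p3; have p0 : 0 < p by exact: lt_trans p1.
have p10 : 0 < p - 1 by rewrite subr_gt0.
have p30 : 0 < 3 - p by rewrite subr_gt0.
have p43 : 0 < 4 * p - 3 by lra.
have pi0 := pi_gt0 R.
(* This is 3 / q. In terms of y the logarithms of p and p - 1 cancel between the two sides, leaving
   an inequality in y alone. *)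
pose y := 3 / p - 1.
have y0 : 0 < y by rewrite subr_gt0 ltr_pdivlMr// mul1r.
have y3 : y < 3 by rewrite ltrBlDr ltr_pdivrMr//; lra.
have y30 : 0 < 3 - y by rewrite subr_gt0.
have Ey : 3 - p = p * y by rewrite /y; field; rewrite gt_eqF.
have E4 : 4 * p - 3 = p * (3 - y) by rewrite /y; field; rewrite gt_eqF.
have Ex : 1 / p = (y + 1) / 3 by rewrite /y; field; rewrite gt_eqF.
have s20 : 0 < Num.sqrt 2 :> R by rewrite sqrtr_gt0.
rewrite -ler_ln ?posrE ?mulr_gt0 ?invr_gt0 ?powR_gt0 ?divr_gt0 ?mulr_gt0//.
rewrite (_ : 6 = 2 * 3 :> R); last by ring.
have -> : Num.sqrt 2 = (2 : R) `^ 2^-1 by rewrite powR12_sqrt.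
rewrite !lnM ?posrE ?mulr_gt0 ?invr_gt0 ?powR_gt0//.
rewrite !lnV ?posrE ?mulr_gt0 ?powR_gt0// !ln_powR.
rewrite ln_div ?posrE ?mulr_gt0// lnM ?posrE//.
rewrite Ey E4 !lnM ?posrE// Ex.
have := slack_ge0 y0 y3.
have : ln 3 <= ln pi :> R by rewrite ler_ln ?posrE// pi_ge3.
have [l3y El3y] : exists t, t = ln (3 - y) by eexists.
rewrite -El3y; generalize (ln (p - 1)) (ln p) (ln y) (ln (2 : R)) (ln (3 : R))
  (ln (pi : R)).
move=> lp1 lp ly l2 l3 lpi hpi hs.
rewrite -subr_ge0.
rewrite [leRHS](_ : _ = 3^-1 * (y * ly + (y + 1) * (l2 - l3y) + 3 / 2 * l2) +
  3^-1 * (lpi - l3)); last by field.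
by apply: addr_ge0; apply: mulr_ge0 => //; rewrite subr_ge0.
Qed.

Unset Implicit Arguments.

Theorem mainTheorem5 (R : realType) (C : R -> R)
    (hC : forall p : R, 1 < p -> p < 3 -> optimal_constant p (C p)) :
  (forall p : R, 1 < p -> p < 3 ->
     pi `^ (- (1 / 3)) * 2 `^ (- 2 - 1 / p) * 3 `^ (- (1 / 3) - 1 / p) *
       (p `^ (- (1 / 3)) * (4 * p - 3) `^ (1 / p) /
        (p - 1) `^ (1 / p - 1 / 3))
     <= C p) /\
  C p @[p --> (1 : R)^'+] --> +oo.
Proof.
have s20 : 0 < 6 * Num.sqrt 2 :> R by rewrite mulr_gt0 ?sqrtr_gt0.
have C_ge p : 1 < p -> p < 3 ->
    ((3 - p) / (3 * (p - 1))) `^ (1 / p - 1 / 3) <= 6 * Num.sqrt 2 * C p.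
  by move=> p1 p3; apply: dirac_sobolev_ge => //; have [] := hC p p1 p3.
split=> [p p1 p3|].
  by rewrite -(ler_pM2l s20); exact: le_trans (paper_bound_le p1 p3) (C_ge _ p1 p3).
(* For p < 3/2 the base exceeds 1 / (2 (p - 1)) >= 1 and the exponent 1/3. *)
have C_ge' p : 1 < p -> p < 3 / 2 ->
    (2 * (p - 1)) `^ (- (1 / 3)) <= 6 * Num.sqrt 2 * C p.
  move=> p1 p32; have p3 : p < 3 by lra.
  apply: le_trans (C_ge p p1 p3).
  have p10 : 0 < p - 1 by rewrite subr_gt0.
  have p210 : 0 < 2 * (p - 1) by rewrite mulr_gt0.
  have b2 : (2 * (p - 1))^-1 <= (3 - p) / (3 * (p - 1)).
    rewrite ler_pdivlMr ?mulr_gt0// [leLHS](_ : _ = 3 / 2); last first.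
      by field; rewrite gt_eqF.
    lra.
  have b1 : 1 <= (2 * (p - 1))^-1 by rewrite invf_ge1//; lra.
  have -> : (2 * (p - 1)) `^ (- (1 / 3)) = (2 * (p - 1))^-1 `^ (1 / 3).
    by rewrite -[(2 * (p - 1))^-1]powR_inv1 ?(ltW p210)// -powRrM mulN1r.
  apply: (@le_trans _ _ ((2 * (p - 1))^-1 `^ (1 / p - 1 / 3))).
    apply: ler_powR => //; rewrite lerBrDr.
    by rewrite ler_pdivlMr ?(lt_trans _ p1)//; lra.
  apply: ge0_ler_powR; rewrite ?nnegrE ?invr_ge0 ?(ltW p210)//.
  - rewrite subr_ge0 ler_pdivlMr ?(lt_trans _ p1)//; lra.
  - by rewrite divr_ge0 ?mulr_ge0 ?subr_ge0 ?(ltW p1) ?(ltW p3).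
apply/cvgryPge => M; near=> p.
have p1 : 1 < p by near: p; exact: nbhs_right_gt.
have p32 : p < 3 / 2 by near: p; apply: nbhs_right_lt; lra.
have M0 : 0 < `|M| + 1 by rewrite ltr_wpDl.
have p10 : 0 < p - 1 by rewrite subr_gt0.
have p210 : 0 < 2 * (p - 1) by rewrite mulr_gt0.
rewrite (le_trans (ler_norm M))// (@le_trans _ _ (`|M| + 1)) ?lerDl//.
rewrite -(ler_pM2l s20); apply: le_trans (C_ge' p p1 p32).
have a0 : 0 < 6 * Num.sqrt 2 * (`|M| + 1) by rewrite mulr_gt0.
(* The threshold solves (2 (p - 1))^(-1/3) = 6 sqrt 2 (|M| + 1) for p. *)
have pM : p < 1 + 2^-1 * (6 * Num.sqrt 2 * (`|M| + 1)) `^ (- 3%:R).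
  near: p; apply: nbhs_right_lt.
  by rewrite ltrDl mulr_gt0 ?powR_gt0// invr_gt0.
have {}pM : 2 * (p - 1) <= (6 * Num.sqrt 2 * (`|M| + 1)) `^ (- 3%:R).
  by rewrite -ler_pdivlMl// mulrC lerBlDl mulrC ltW.
have : ((6 * Num.sqrt 2 * (`|M| + 1)) `^ (- 3%:R)) `^ (- (1 / 3)) <=
    (2 * (p - 1)) `^ (- (1 / 3)).
  rewrite !powRN lef_pV2 ?posrE ?powR_gt0 ?invr_gt0 ?powR_gt0//.
  by rewrite -powRN; apply: ge0_ler_powR; rewrite ?nnegrE ?powR_ge0 ?(ltW p210).
rewrite -powRrM (_ : - 3%:R * - (1 / 3) = 1) ?powRr1 ?(ltW a0)//.
by field.
Unshelve. all: by end_near. Qed.
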